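(* Let $P=P_n(\{z_I\})$ be a generalized permutahedron contained in $\mathbb{R}^n_{>0}$, let $\pi=\pi_1|\cdots|\pi_k$ be an ordered partition of $[n]$ and $0\le q\le1$. Then \[ \mathrm{Vol}_n(P^\pi(q))=\frac{z_\pi}{\sqrt{|\pi_1|\cdots|\pi_k|}}\,\mathrm{Vol}_{n-k}(P_\pi)\int_q^1\int_q^{t_k}\cdots\int_q^{t_2}t_1^{|\pi_1|-1}\cdots t_k^{|\pi_k|-1}\,dt_1\cdots dt_k, \] where $z_\pi=z_\pi^{\pi_1}\cdots z_\pi^{\pi_k}$; in particular this volume is a polynomial in $q$.
   Context: For real numbers $z_I$ ($I\subseteq[n]$, $z_\emptyset=0$) let $P_n(\{z_I\})=\{t\in\mathbb{R}^n:\sum_{i=1}^n t_i=z_{[n]},\ \sum_{i\in I}t_i\ge z_I\ \forall I\subseteq[n]\}$; a generalized permutahedron is such a polytope with supermodular parameters. A linear functional $\sum a_ix_i$ has type $\pi$ if $a_i=a_j$ exactly when $i,j$ lie in the same block, and $a_i<a_j$ when $i\in\pi_s,j\in\pi_t$ with $s<t$; $P_\pi$ is the face of $P$ maximizing any functional of type $\pi$ (of dimension at most $n-k$; $\mathrm{Vol}_{n-k}$ is $(n-k)$-dimensional volume). For $i=0,\dots,k$, $P_\pi^i$ is obtained from $P_\pi$ by multiplying by $q$ the coordinates with indices in $\pi_1\cup\cdots\cup\pi_i$; the $(\pi,q)$-lifting is $P^\pi(q)=\mathrm{conv}(P_\pi^0\cup\cdots\cup P_\pi^k)\subset\mathbb{R}^n$.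 Also $z_\pi^{\pi_i}:=z_{\pi_1\cup\cdots\cup\pi_i}-z_{\pi_1\cup\cdots\cup\pi_{i-1}}$. *)

(* Defs.v *)
From HB Require Import structures.
From mathcomp Require Import all_boot all_order all_algebra.
From mathcomp Require Import all_classical all_reals all_analysis.

Set Implicit Arguments.
Unset Strict Implicit.
Unset Printing Implicit Defensive.

Import Order.TTheory GRing.Theory Num.Theory.
Import numFieldNormedType.Exports.

Local Open Scope classical_set_scope.
Local Open Scope ring_scope.

Section lebesgue_tuple.
Context {R : realType}.
Local Notation T := (measurableTypeR R).

Definition tcons n (x : T * n.-tuple T) : n.+1.-tuple T :=
  [the n.+1.-tuple T of x.1 :: x.2].

Section step.
Variables (n : nat) (m : {sigma_finite_measure set (n.-tuple T) -> \bar R}).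

Definition lebesgue_tuple_step : set (n.+1.-tuple T) -> \bar R :=
  pushforward (@lebesgue_measure R \x m)%E (@tcons n).

Let measurable_tcons : measurable_fun setT (@tcons n).
Proof. exact: measurable_cons. Qed.

Let step0 : lebesgue_tuple_step set0 = 0%E.
Proof. exact: measure0. Qed.

Let step_ge0 A : (0 <= lebesgue_tuple_step A)%E.
Proof. exact: measure_ge0. Qed.

Let step_sigma_additive : semi_sigma_additive lebesgue_tuple_step.
Proof.
exact: (@measure_semi_sigma_additive _ _ _
  (pushforward (@lebesgue_measure R \x m)%E (@tcons n))).
Qed.

HB.instance Definition _ := isMeasure.Build _ _ _ lebesgue_tuple_step
  step0 step_ge0 step_sigma_additive.

Let step_sigma_finite : sigma_finite setT lebesgue_tuple_step.
Proof.
pose g (t : n.+1.-tuple T) : T * n.-tuple T :=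
  (tnth t ord0, [tuple of behead t]).
have mg : measurable_fun setT g.
  by apply: measurable_fun_pair;
    [exact: measurable_tnth|exact: measurable_behead].
have gK : cancel (@tcons n) g by move=> [x t]; congr pair; exact: val_inj.
have /sigma_finiteP[F [TF ndF Foo]] := sigma_finiteT (@lebesgue_measure R).
have /sigma_finiteP[G [TG ndG Goo]] := sigma_finiteT m.
exists (fun i => g @^-1` (F i `*` G i)).
  rewrite -preimage_bigcup; apply/seteqP; split => // t _.
  have [i _ Fi] : (\bigcup_i F i) (g t).1 by rewrite -TF.
  have [j _ Gj] : (\bigcup_i G i) (g t).2 by rewrite -TG.
  exists (maxn i j) => //; split.
    by move: Fi; exact/subsetPset/ndF/leq_maxl.
  by move: Gj; exact/subsetPset/ndG/leq_maxr.
move=> i; have [mF Fi] := Foo i; have [mG Gi] := Goo i; split.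
  by rewrite -[_ @^-1` _]setTI; apply: mg => //; exact: measurableX.
rewrite /lebesgue_tuple_step /pushforward -comp_preimage.
rewrite (_ : g \o _ = id); last exact/funext.
by rewrite preimage_id product_measure1E// lte_mul_pinfty// ge0_fin_numE.
Qed.

HB.instance Definition _ :=
  @Measure_isSigmaFinite.Build _ _ _ lebesgue_tuple_step step_sigma_finite.

End step.

Fixpoint lebesgue_tuple n : {sigma_finite_measure set (n.-tuple T) -> \bar R} :=
  match n with
  | 0 => [the {sigma_finite_measure set (0.-tuple T) -> \bar R} of
           dirac [tuple]]
  | n'.+1 => [the {sigma_finite_measure set (n'.+1.-tuple T) -> \bar R} of
           lebesgue_tuple_step (lebesgue_tuple n')]
  end.

End lebesgue_tuple.

Section euclidean_volume.
Context {R : realType}.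

Definition lebesgue_row n (A : set 'rV[R]_n) : \bar R :=
  lebesgue_tuple n [set t | A (\row_i tnth t i)].

Definition flat_chart d n (M : 'M[R]_(d, n)) (b : 'rV[R]_n) (u : 'rV[R]_d)
  : 'rV[R]_n := b + u *m M.

(* The d-dimensional volume of a Borel set A contained in a d-dimensional
   affine subspace of R^n is the Lebesgue measure of A read in orthonormal
   affine coordinates of that subspace (the rows of M are orthonormal).  The
   set of values below is then a singleton, since Lebesgue measure is invariant
   under isometries and A is null in every chart when it spans less than d
   dimensions.  It is empty, and the default 0 is returned, if A lies in no
   d-dimensional affine subspace. *)
Definition flat_volume d n (A : set 'rV[R]_n) : \bar R :=
  xget 0%E [set v | exists (M : 'M[R]_(d, n)) (b : 'rV[R]_n),
    [/\ M *m M^T = 1%:M, A `<=` range (flat_chart M b) &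
        v = lebesgue_row (flat_chart M b @^-1` A)]].

Definition convex_hull n (A : set 'rV[R]_n) : set 'rV[R]_n :=
  smallest (@convex_set R 'rV[R]_n) A.

End euclidean_volume.

Section generalized_permutahedra.
Context {R : realType} {n : nat}.

Definition polytope_of (z : {set 'I_n} -> R) : set 'rV[R]_n :=
  [set t | \sum_i t 0 i = z [set: 'I_n]%SET /\
           forall I : {set 'I_n}, z I <= \sum_(i in I) t 0 i].

Definition supermodular (z : {set 'I_n} -> R) :=
  forall I J : {set 'I_n}, z I + z J <= z (I :|: J)%SET + z (I :&: J)%SET.

Definition dotv (a x : 'rV[R]_n) : R := \sum_i a 0 i * x 0 i.

Definition max_face (P : set 'rV[R]_n) (a : 'rV[R]_n) : set 'rV[R]_n :=
  [set x | P x /\ forall y, P y -> dotv a y <= dotv a x].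

Definition scale_coords (q : R) (I : {set 'I_n}) (x : 'rV[R]_n) : 'rV[R]_n :=
  \row_i (if i \in I then q * x 0 i else x 0 i).

Section ordered_partitions.
Context {k : nat}.

Definition ordered_partition (pi : 'I_k -> {set 'I_n}) :=
  injective pi /\ finset.partition [set pi s | s : 'I_k]%SET [set: 'I_n]%SET.

Definition has_type (pi : 'I_k -> {set 'I_n}) (a : 'rV[R]_n) :=
  (forall i j, a 0 i = a 0 j <-> exists s, i \in pi s /\ j \in pi s) /\
  (forall (s t : 'I_k) i j,
     (s < t)%N -> i \in pi s -> j \in pi t -> a 0 i < a 0 j).

(* Union of the first r blocks, i.e. of the blocks with (0-based) index < r. *)
Definition first_blocks (pi : 'I_k -> {set 'I_n}) (r : nat) : {set 'I_n} :=
  (\bigcup_(s < k | (s < r)%N) pi s)%SET.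

(* F is meant to be the face of type pi. *)
Definition lifting (pi : 'I_k -> {set 'I_n}) (q : R) (F : set 'rV[R]_n) :
    set 'rV[R]_n :=
  convex_hull (\bigcup_(r in [set r : nat | (r <= k)%N])
                 scale_coords q (first_blocks pi r) @` F).

Definition block_height (z : {set 'I_n} -> R) (pi : 'I_k -> {set 'I_n})
    (s : 'I_k) : R :=
  z (first_blocks pi s.+1) - z (first_blocks pi s).

End ordered_partitions.

End generalized_permutahedra.

(* rev_iterated_integral q [:: c_k; ...; c_1] u is
   \int_q^u \int_q^(t_k) ... \int_q^(t_2)
     t_1 ^ (c_1 - 1) ... t_k ^ (c_k - 1) dt_1 ... dt_k. *)
Fixpoint rev_iterated_integral (R : realType) (q : R) (c : seq nat) (u : R)
  : R :=
  match c with
  | [::] => 1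
  | m :: c' => \int[lebesgue_measure]_(t in `[q, u])
                 (t ^+ m.-1 * rev_iterated_integral q c' t)
  end.

Definition iterated_integral (R : realType) (q : R) k (c : 'I_k -> nat) : R :=
  rev_iterated_integral q (rev [seq c s | s <- enum 'I_k]) 1.

(* Main.v *)
(* By supermodularity (greedy algorithm) the face of type pi consists of the
   points for which all the constraints z_(pi_1 u ... u pi_r) are tight, and it
   is a product of one polytope per block, the coordinates of the s-th block
   summing up to h_s = z_pi^(pi_s).  Hence the lifting is the set of the points
   obtained by scaling the blocks of a point of the face by factors
   q <= t_1 <= ... <= t_k <= 1, and t_s is read off as (sum of block s) / h_s.
   Let M be an orthonormal basis of the space of vectors with zero block sums.
   In the coordinates (t, v) |-> sum_s t_s (h_s / |pi_s|) 1_(pi_s) + v M, whose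
   determinant is prod_s h_s / sqrt |pi_s|, the slice of the lifting at t is a
   linear copy of the face, read in the chart M, with volume factor
   prod_s t_s ^ (|pi_s| - 1); Fubini concludes.  The linear change of variables
   is proved by induction on the dimension, factoring a matrix into block
   triangular ones, and an orthonormal chart of the face may be replaced by any
   other one since the face is null in both unless they span the same flat. *)
Require Import Defs.
From mathcomp Require Import all_boot all_order all_algebra.
From mathcomp Require Import all_classical all_reals all_analysis.
From mathcomp Require Import measurable_realfun ring lra.

Set Implicit Arguments.
Unset Strict Implicit.
Unset Printing Implicit Defensive.

Import Order.TTheory GRing.Theory Num.Theory.
Import numFieldNormedType.Exports.

Local Open Scope classical_set_scope.
Local Open Scope ring_scope.

(** * Lebesgue measure on row vectors *)

Definition row_of_tuple (R : realType) n (t : n.-tuple (measurableTypeR R)) :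
  'rV[R]_n := \row_i tnth t i.

(** Measurability is tested on tuples, since [lebesgue_row] measures a set of rows through its
    preimage there. *)
Definition mrow (R : realType) n (A : set 'rV[R]_n) : Prop :=
  measurable (@row_of_tuple R n @^-1` A).

Lemma lebesgue_rowE (R : realType) n (A : set 'rV[R]_n) :
  lebesgue_row A = lebesgue_tuple n (@row_of_tuple R n @^-1` A).
Proof. by []. Qed.

Lemma row_of_tcons (R : realType) n (x : R) (t : n.-tuple (measurableTypeR R)) :
  row_of_tuple (tcons (x, t)) = row_mx (x%:M : 'rV_1) (row_of_tuple t) :> 'rV_(1 + n).
Proof.
apply/rowP => i; rewrite !mxE; case: splitP => j ij.
  rewrite (ord1 j) in ij *; rewrite !mxE/= mulr1n (_ : i = ord0)//; exact/val_inj.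
rewrite !mxE (_ : i = lift ord0 j) ?tnthS//; last exact/val_inj.
Qed.

Lemma lebesgue_row_ge0 (R : realType) n (A : set 'rV[R]_n) :
  (0 <= lebesgue_row A)%E.
Proof. exact: measure_ge0. Qed.

Lemma le_lebesgue_row (R : realType) n (A B : set 'rV[R]_n) :
  mrow A -> mrow B -> A `<=` B -> (lebesgue_row A <= lebesgue_row B)%E.
Proof.
move=> mA mB AB; rewrite !lebesgue_rowE; apply: le_measure; rewrite ?inE//.
by move=> t; exact: AB.
Qed.

Definition dotrow (R : realType) n (w x : 'rV[R]_n) : R := (x *m w^T) 0 0.

Lemma measurable_affine_row (R : realType) n p (B : 'M[R]_(n, p)) (c : 'rV[R]_p)
    (j : 'I_p) :
  measurable_fun setT (fun t : n.-tuple (measurableTypeR R) =>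
    (row_of_tuple t *m B + c) 0 j : measurableTypeR R).
Proof.
rewrite (_ : (fun t => _) = (fun t : n.-tuple (measurableTypeR R) =>
    \sum_i tnth t i * B i j + c 0 j)); last first.
  by apply/funext => t; rewrite !mxE; congr +%R; apply: eq_bigr => i _; rewrite mxE.
apply: measurable_funD => //.
apply: (@measurable_sum _ _ _ setT _ _ (fun i (t : n.-tuple (measurableTypeR R)) => tnth t i * B i j)) => i.
by apply: measurable_funM => //; exact: measurable_tnth.
Qed.

Lemma mrow_affine (R : realType) n p (B : 'M[R]_(n, p)) (c : 'rV[R]_p) A :
  mrow A -> mrow [set x | A (x *m B + c)].
Proof.
move=> mA.
pose f (t : n.-tuple (measurableTypeR R)) : p.-tuple (measurableTypeR R) :=
  [tuple (row_of_tuple t *m B + c) 0 i | i < p].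
have mf : measurable_fun setT f.
  apply/measurable_fun_tnthP => i; rewrite (_ : _ \o _ = (fun t => (row_of_tuple t *m B + c) 0 i)).
    exact: measurable_affine_row.
  by apply/funext => t /=; rewrite tnth_mktuple.
rewrite /mrow (_ : _ @^-1` _ = f @^-1` (@row_of_tuple R p @^-1` A)).
  by rewrite -[X in measurable X]setTI; apply: mf.
apply/seteqP; split => t /=; rewrite (_ : row_of_tuple (f t) = row_of_tuple t *m B + c)//;
  by apply/rowP => i; rewrite [LHS]mxE tnth_mktuple.
Qed.

Lemma mrow_le (R : realType) n (w : 'rV[R]_n) (c : R) :
  mrow [set x | c <= dotrow w x].
Proof.
have := @measurable_affine_row R n 1 w^T 0 0 => mf.
rewrite /mrow -[X in measurable X]setTI.
rewrite (_ : setT `&` _ = setT `&` (fun t => (row_of_tuple t *m w^T + 0) 0 0 : measurableTypeR R) @^-1` `[c, +oo[%classic).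
  by apply: mf => //; exact: measurable_itv.
by congr setI; apply/seteqP; split => t /=; rewrite in_itv/= andbT addr0.
Qed.

Lemma mrowI (R : realType) n (A B : set 'rV[R]_n) :
  mrow A -> mrow B -> mrow (A `&` B).
Proof. by move=> mA mB; rewrite /mrow preimage_setI; exact: measurableI. Qed.

Lemma mrow_forall (R : realType) n (I : finType) (A : I -> set 'rV[R]_n) :
  (forall i, mrow (A i)) -> mrow [set x | forall i, A i x].
Proof.
move=> mA; rewrite /mrow (_ : _ @^-1` _ = \bigcap_(i in [set: I]) (@row_of_tuple R n @^-1` A i)).
  by apply: fin_bigcap_measurable => // i _; exact: mA.
by apply/seteqP; split => t /= H i; [move=> _; exact: H | exact: (H i Logic.I)].
Qed.

Lemma mrow_tcons (R : realType) n (A : set 'rV[R]_(1 + n)) : mrow A ->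
  measurable (@tcons R n @^-1` (@row_of_tuple R (1 + n) @^-1` A)).
Proof.
move=> mA; rewrite -[X in measurable X]setTI.
have mt : measurable_fun setT (@tcons R n) by exact: measurable_cons.
by apply: mt.
Qed.

(** Fubini with the first coordinate outermost: the product measure is by construction the integral
    of the measures of the sections. *)
Lemma lebesgue_rowS (R : realType) n (A : set 'rV[R]_(1 + n)) : mrow A ->
  lebesgue_row A = (\int[lebesgue_measure]_x
    lebesgue_row [set v : 'rV_n | A (row_mx (x%:M : 'rV_1) v)])%E.
Proof.
move=> mA; rewrite lebesgue_rowE /= /lebesgue_tuple_step /pushforward /product_measure1.
apply: eq_integral => x _ /=; rewrite lebesgue_rowE; congr (lebesgue_tuple n _).
apply/seteqP; split => t; rewrite /xsection /= inE /=; rewrite row_of_tcons//.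
Qed.

Lemma measurable_slice (R : realType) n (A : set 'rV[R]_(1 + n)) : mrow A ->
  measurable_fun setT (fun x : measurableTypeR R =>
    lebesgue_row [set v : 'rV_n | A (row_mx (x%:M : 'rV_1) v)]).
Proof.
move=> mA; have := measurable_fun_xsection (lebesgue_tuple n) (mrow_tcons mA).
congr (measurable_fun _ _); apply/funext => x /=; congr (lebesgue_tuple n _).
apply/seteqP; split => t; rewrite /xsection /= inE /=; rewrite row_of_tcons//.
Qed.

Lemma mrow_slice (R : realType) n (A : set 'rV[R]_(1 + n)) (x : R) : mrow A ->
  mrow [set v : 'rV_n | A (row_mx (x%:M : 'rV_1) v)].
Proof.
move=> mA; have := @mrow_affine R n (1 + n) (row_mx 0 1%:M) (row_mx x%:M 0) A mA.
congr mrow; apply/seteqP; split => v /=; rewrite mul_mx_row mulmx0 mulmx1 add_row_mx add0r addr0//.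
Qed.

(** Tonelli exchanges the order, so that the first coordinate is integrated innermost. This suits
    maps and sets that are simple along lines parallel to the first axis. *)
Lemma lebesgue_rowS_swap (R : realType) n (A : set 'rV[R]_(1 + n)) : mrow A ->
  lebesgue_row A = (\int[lebesgue_tuple n]_t
    lebesgue_measure [set x : measurableTypeR R | A (row_mx (x%:M : 'rV_1) (row_of_tuple t))])%E.
Proof.
move=> mA; rewrite lebesgue_rowE /= /lebesgue_tuple_step /pushforward /product_measure1.
have := indic_fubini_tonelli (@lebesgue_measure R) (lebesgue_tuple n) (mrow_tcons mA).
rewrite (indic_fubini_tonelli_FE _ (mrow_tcons mA)) (indic_fubini_tonelli_GE _ (mrow_tcons mA)).
move=> ->; apply: eq_integral => t _ /=; congr lebesgue_measure.
apply/seteqP; split => x; rewrite /ysection /= inE /=; rewrite row_of_tcons//.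
Qed.

(** * Linear change of variables *)

(** By uniqueness of Lebesgue measure it suffices that [|a|] times the pushforward gives half-open
    intervals their length. *)
Lemma lebesgue_measure_affine (R : realType) (a b : R) (A : set (measurableTypeR R)) :
  a != 0 -> measurable A ->
  lebesgue_measure [set x : measurableTypeR R | A (a * x + b)] =
    (`|a|^-1%:E * lebesgue_measure A)%E.
Proof.
move=> a0 mA.
pose f (x : measurableTypeR R) : measurableTypeR R := a * x + b.
have mf : measurable_fun setT f.
  by apply: measurable_funD => //; exact: mulrl_measurable.
have := @lebesgue_measure_unique R
  (mscale (NngNum (normr_ge0 a)) (pushforward lebesgue_measure f)) _ A mA.
move=> /(_ mf) ->; last first.
  move=> _ [[u v]] _ <-; 
  change (lebesgue_measure (`]u, v]%classic : set R) =
    (`|a|%:E * lebesgue_measure (f @^-1` `]u, v]%classic))%E).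
  have [a_gt0|a_lt0] : 0 < a \/ a < 0 by move: a0; rewrite neq_lt => /orP[]; [right|left].
  - rewrite (_ : _ @^-1` _ = `](u - b) / a, (v - b) / a]%classic).
      rewrite [LHS]lebesgue_measure_itv lebesgue_measure_itv/= !lte_fin ltr_pM2r ?invr_gt0// ltrD2r gtr0_norm//.
      by case: ifPn => _; rewrite ?mule0// -!EFinB -EFinM; congr EFin; field.
    apply/seteqP; split => x /=; rewrite !in_itv/= ltr_pdivrMr// ler_pdivlMr// /f;
      by rewrite ltrBlDr lerBrDr [x * a]mulrC.
  - rewrite (_ : _ @^-1` _ = `[(v - b) / a, (u - b) / a[%classic).
      rewrite [LHS]lebesgue_measure_itv lebesgue_measure_itv/= !lte_fin ltr_nM2r ?invr_lt0// ltrD2r ltr0_norm//.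
      by case: ifPn => _; rewrite ?mule0// -!EFinB -EFinM; congr EFin; field.
    apply/seteqP; split => x /=; rewrite !in_itv/= ltr_ndivlMr// ler_ndivrMr// /f;
      by rewrite ltrBlDr lerBrDr [x * a]mulrC andbC.
by rewrite /mscale/= /pushforward muleA -EFinM mulVf ?normr_eq0// mul1e.
Qed.

(** Stated for preimages, so a matrix [A] contributes the inverse of [|\det A|]; measurability is
    bundled in so that maps compose. *)
Definition scales_volume (R : realType) n (f : 'rV[R]_n -> 'rV[R]_n) (a : R) :=
  forall S, mrow S -> mrow (f @^-1` S) /\
    lebesgue_row (f @^-1` S) = (a%:E * lebesgue_row S)%E.

Lemma scales_volume_comp (R : realType) n (f g : 'rV[R]_n -> 'rV[R]_n) (a b : R) :
  scales_volume f a -> scales_volume g b -> scales_volume (g \o f) (a * b).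
Proof.
move=> sf sg S mS; have [mgS gS] := sg _ mS; have [mfS fS] := sf _ mgS; split=> //.
by rewrite comp_preimage fS gS muleA -EFinM.
Qed.

(** The first coordinate [x] is kept, and on the slice at [x] the map is [v *m D] plus a translation
    that absorbs the shear [x *: b]. *)
Lemma scales_volume_upper (R : realType) n (b : 'rV[R]_n) (D : 'M[R]_n)
    (c : 'rV[R]_n) (a : R) : 0 <= a ->
  (forall x : 'rV[R]_n, scales_volume (fun v => v *m D + x) a) ->
  scales_volume (fun y : 'rV[R]_(1 + n) =>
    y *m block_mx (1%:M : 'M[R]_1) b 0 D + row_mx 0 c) a.
Proof.
move=> a0 sD S mS; have mfS := mrow_affine (block_mx (1%:M : 'M[R]_1) b 0 D) (row_mx 0 c) mS.
split=> //.
rewrite !lebesgue_rowS// -ge0_integralZl//; last exact: measurable_slice.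
apply: eq_integral => x _.
have [_ <-] := sD (x%:M *m b + c) _ (mrow_slice x mS).
congr lebesgue_row; apply/seteqP; split => v /=;
  by rewrite mul_row_block !mulmx0 mulmx1 addr0 add_row_mx addr0 addrA [_ + v *m D]addrC.
Qed.

(** All coordinates but the first are kept, and for fixed values of these the first undergoes a
    one-dimensional affine map of slope [a]. *)
Lemma scales_volume_lower (R : realType) n (a : R) (c : 'cV[R]_n) (c0 : R) :
  a != 0 ->
  scales_volume (fun y : 'rV[R]_(1 + n) =>
    y *m block_mx (a%:M : 'M[R]_1) 0 c 1%:M + row_mx c0%:M 0) `|a|^-1.
Proof.
move=> a0 S mS.
have mfS := mrow_affine (block_mx (a%:M : 'M[R]_1) 0 c 1%:M) (row_mx c0%:M 0) mS.
split=> //.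
have mslice T t : mrow T -> measurable [set x : measurableTypeR R |
    T (row_mx (x%:M : 'rV_1) (@row_of_tuple R n t))].
  move=> mT; have := measurable_ysection t (mrow_tcons mT).
  congr measurable; apply/seteqP; split => x; rewrite /ysection /= inE /=; rewrite row_of_tcons//.
rewrite !lebesgue_rowS_swap// -ge0_integralZl//; last first.
- have := measurable_fun_ysection (@lebesgue_measure R) (mrow_tcons mS).
  congr (measurable_fun _ _); apply/funext => t /=; congr lebesgue_measure.
  apply/seteqP; split => x; rewrite /ysection /= inE /=; rewrite row_of_tcons//.
apply: eq_integral => t _.
rewrite -(@lebesgue_measure_affine R a ((row_of_tuple t *m c) 0 0 + c0)) //; last exact: mslice.
congr lebesgue_measure; apply/seteqP; split => x /=;
  rewrite mul_row_block !mulmx0 mulmx1 add0r add_row_mx addr0 -scalar_mxM mulrC;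
  by rewrite [row_of_tuple t *m c]mx11_scalar -!raddfD/= addrA [(_%:M : 'M[R]_1) 0 0]mxE.
Qed.

(** A nonzero corner [a] lets [A] factor into a block lower and a block upper triangular matrix, the
    latter containing the Schur complement [E] of [a]. *)
Lemma scales_volume_pivot (R : realType) n (A : 'M[R]_(1 + n)) (c : 'rV[R]_(1 + n)) :
  (forall (D : 'M[R]_n) (x : 'rV[R]_n), D \in unitmx ->
     scales_volume (fun v => v *m D + x) `|\det D|^-1) ->
  A \in unitmx -> A 0 0 != 0 ->
  scales_volume (fun y => y *m A + c) `|\det A|^-1.
Proof.
move=> IH Au a0; set a := A 0 0 in a0.
pose b := ursubmx A; pose l := dlsubmx A; pose D := drsubmx A.
pose E := D - l *m (a^-1 *: b).
have AE : A = block_mx (a%:M : 'M[R]_1) 0 l 1%:M *m block_mx (1%:M : 'M[R]_1) (a^-1 *: b) 0 E.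
  rewrite mulmx_block !mulmx0 !mul0mx !mulmx1 !addr0 mul1mx /E addrC subrK.
  rewrite mul_scalar_mx scalerA mulfV// scale1r -[LHS]submxK; congr block_mx.
  by rewrite [LHS]mx11_scalar !mxE; congr (A _ _)%:M; apply/val_inj.
have dA : \det A = a * \det E.
  by rewrite AE det_mulmx det_lblock det_ublock !det1 !mul1r det_scalar1 mulr1.
have Eu : E \in unitmx.
  by move: Au; rewrite !unitmxE !unitfE dA mulf_eq0 negb_or => /andP[].
rewrite dA normrM invfM.
have -> : (fun y => y *m A + c) =
   (fun y : 'rV[R]_(1 + n) => y *m block_mx (1%:M : 'M[R]_1) (a^-1 *: b) 0 E + row_mx 0 (rsubmx c - c 0 0 *: (a^-1 *: b)))
   \o (fun y => y *m block_mx (a%:M : 'M[R]_1) 0 l 1%:M + row_mx (c 0 0)%:M 0).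
  apply/funext => y /=; rewrite mulmxDl -mulmxA -AE -addrA; congr (_ + _).
  rewrite mul_row_block !mulmx0 mulmx1 mul0mx !addr0 add_row_mx addr0 mul_scalar_mx addrC subrK.
  rewrite -[LHS]hsubmxK; congr row_mx.
  by rewrite [LHS]mx11_scalar !mxE; congr (c _ _)%:M; apply/val_inj.
apply: scales_volume_comp; first exact: scales_volume_lower.
by apply: scales_volume_upper => [|x]; [rewrite invr_ge0|exact: IH].
Qed.

Theorem scales_volume_affine (R : realType) n (A : 'M[R]_n) (c : 'rV[R]_n) :
  A \in unitmx -> scales_volume (fun y => y *m A + c) `|\det A|^-1.
Proof.
elim: n A c => [A c _ S mS|n IH]; last rewrite -[n.+1]/(1 + n)%N => A c Au.
  rewrite det_mx00 normr1 invr1 mul1e (_ : _ @^-1` _ = S)//.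
  by apply/seteqP; split => x /=; rewrite [_ + _]thinmx0 [x]thinmx0.
have [a0|a0] := boolP (A 0 0 != 0); first exact: scales_volume_pivot.
(* The corner is zero here; if the column below it vanished too, [A] would be singular. *)
have [i li] : exists i, dlsubmx A i 0 != 0.
  apply/existsP; apply: contraLR Au; rewrite negb_exists => /forallP l0.
  rewrite unitmxE unitfE negbK -[A]submxK.
  rewrite (_ : dlsubmx _ = 0); last first.
    by apply/matrixP => j k; rewrite (ord1 k) [RHS]mxE; move: (l0 j); rewrite negbK => /eqP.
  rewrite (_ : ulsubmx _ = 0); last first.
    apply/matrixP => j k; rewrite !ord1 !mxE; move: a0; rewrite negbK => /eqP <-.
    by congr (A _ _); apply/val_inj.
  by rewrite det_ublock det_mx11 mxE mul0r.
(* Multiplying by [U e] adds the row of that nonzero entry to the first row, which creates a pivot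
   without changing the determinant. *)
pose e : 'rV[R]_n := delta_mx 0 i.
pose U (e : 'rV[R]_n) : 'M[R]_(1 + n) := block_mx (1%:M : 'M[R]_1) e 0 1%:M.
have UK : U (- e) *m U e = 1%:M.
  rewrite /U mulmx_block !mulmx0 !mul0mx !mulmx1 !mul1mx !addr0 add0r subrr.
  by rewrite -scalar_mx_block.
have dU f : \det (U f) = 1 by rewrite det_ublock !det1 mulr1.
pose A' := U e *m A.
have A'u : A' \in unitmx by rewrite unitmx_mul Au andbT unitmxE dU unitr1.
have a'0 : A' 0 0 != 0.
  rewrite /A' -[A]submxK /U mulmx_block.
  rewrite (_ : 0 = lshift n 0 :> 'I_(1 + n)); last exact/val_inj.
  rewrite block_mxEul mul1mx mxE (_ : ulsubmx _ 0 0 = 0); last first.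
    move: a0; rewrite negbK !mxE => /eqP <-; congr (A _ _); exact/val_inj.
  by rewrite add0r -rowE mxE.
rewrite (_ : `|\det A|^-1 = 1 * `|\det A'|^-1); last by rewrite det_mulmx dU !mul1r.
have -> : (fun y => y *m A + c) = (fun y => y *m A' + c) \o (fun y => y *m U (- e) + row_mx 0 0).
  by apply/funext => y /=; rewrite row_mx0 addr0 -mulmxA /A' [U (- e) *m _]mulmxA UK mul1mx.
apply: scales_volume_comp; last exact: scales_volume_pivot.
by apply: scales_volume_upper => // x; have := IH 1%:M x (unitmx1 _ _); rewrite det1 normr1 invr1.
Qed.

Lemma lebesgue_row_affine (R : realType) n (A : 'M[R]_n) (c : 'rV[R]_n) S :
  A \in unitmx -> mrow S ->
  lebesgue_row [set y | S (y *m A + c)] = (`|\det A|^-1%:E * lebesgue_row S)%E.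
Proof. by move=> Au mS; have [] := scales_volume_affine c Au mS. Qed.

(** * Null hyperplanes and boxes of finite volume *)

Lemma dotrowE (R : realType) n (w x : 'rV[R]_n) :
  dotrow w x = \sum_i x 0 i * w 0 i.
Proof. by rewrite /dotrow mxE; apply: eq_bigr => i _; rewrite mxE. Qed.

Lemma dotrowB (R : realType) n (w x y : 'rV[R]_n) :
  dotrow w (x - y) = dotrow w x - dotrow w y.
Proof. by rewrite /dotrow mulmxBl !mxE. Qed.

Lemma mrow_hyperplane (R : realType) n (w : 'rV[R]_n) (c : R) :
  mrow [set x | dotrow w x = c].
Proof.
have := mrowI (mrow_le w c) (mrow_le (- w) (- c)); congr mrow.
apply/seteqP; split => x /=; rewrite /dotrow linearN mulmxN [(- _ : 'M[R]_1) _ _]mxE lerN2.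
  by move=> [? ?]; apply/le_anti/andP.
by move=> ->.
Qed.

(** If the first entry of [w] is zero, the slices are hyperplanes one dimension lower; otherwise
    every line parallel to the first axis meets the hyperplane in one point. *)
Lemma lebesgue_row_hyperplane (R : realType) n (w : 'rV[R]_n) (c : R) :
  w != 0 -> lebesgue_row [set x | dotrow w x = c] = 0%E.
Proof.
elim: n w c => [w c|n IH]; first by rewrite thinmx0 eqxx.
rewrite -[n.+1]/(1 + n)%N => w c.
rewrite -[w]hsubmxK; set w0 := lsubmx w; set w' := rsubmx w => ww.
have dE x v : dotrow (row_mx w0 w') (row_mx (x%:M : 'rV_1) v) = x * w0 0 0 + dotrow w' v.
  rewrite /dotrow tr_row_mx mul_row_col mul_scalar_mx mxE; congr +%R.
  by rewrite !mxE.
have mH := mrow_hyperplane (row_mx w0 w') c.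
have [w00|w00] := eqVneq (w0 0 0) 0.
  rewrite lebesgue_rowS// integral0_eq// => x _.
  rewrite -(IH w' c) ?(contraNneq _ ww)//; last first.
    by move=> ->; rewrite [w0]mx11_scalar w00 raddf0 row_mx0.
  by congr lebesgue_row; apply/seteqP; split => v /=; rewrite dE w00 mulr0 add0r.
rewrite lebesgue_rowS_swap// integral0_eq// => t _.
rewrite (_ : [set x | _] = [set (c - dotrow w' (row_of_tuple t)) / w0 0 0])%classic.
  exact: lebesgue_measure_set1.
apply/seteqP; split => x /=; rewrite dE.
  by move=> <-; rewrite addrK mulfK.
by move=> ->; rewrite divfK// subrK.
Qed.

Lemma sub_hyperplane_null (R : realType) n (w : 'rV[R]_n) (c : R) A :
  w != 0 -> mrow A -> (forall x, A x -> dotrow w x = c) -> lebesgue_row A = 0%E.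
Proof.
move=> w0 mA AH; apply/eqP; rewrite eq_le lebesgue_row_ge0 andbT.
rewrite -(lebesgue_row_hyperplane c w0).
exact: le_lebesgue_row mA (mrow_hyperplane w c) AH.
Qed.

Definition box (R : realType) n (C : R) : set 'rV[R]_n :=
  [set x | forall i, `|x 0 i| <= C].

Lemma dotrow_delta (R : realType) n (i : 'I_n) (a : R) (x : 'rV[R]_n) :
  dotrow (a *: delta_mx 0 i) x = a * x 0 i.
Proof.
rewrite dotrowE (bigD1 i)//= big1 ?addr0 => [|j ji].
  by rewrite !mxE !eqxx mulr1 mulrC.
by rewrite !mxE (negbTE ji) andbF !mulr0.
Qed.

Lemma mrow_box (R : realType) n (C : R) : mrow (@box R n C).
Proof.
apply: mrow_forall => i.
have := mrowI (mrow_le (1 *: delta_mx 0 i : 'rV[R]_n) (- C)) (mrow_le (-1 *: delta_mx 0 i) (- C)).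
congr mrow; apply/seteqP; split => x /=; rewrite !dotrow_delta mul1r mulN1r lerN2.
  by move=> [? ?]; rewrite ler_norml; apply/andP.
by rewrite ler_norml => /andP.
Qed.

Lemma lebesgue_row_box (R : realType) n (C : R) :
  (lebesgue_row (@box R n C) < +oo)%E.
Proof.
elim: n => [|n IH].
  apply: le_lt_trans (_ : 1%E < _)%E; last exact: ltry.
  by rewrite lebesgue_rowE /= diracE; case: (_ \in _).
rewrite -[n.+1]/(1 + n)%N lebesgue_rowS; last exact: mrow_box.
have boxE (x : measurableTypeR R) : lebesgue_row [set v : 'rV_n | box C (row_mx (x%:M : 'rV_1) v)] =
   ((\1_`[- C, C]%classic x)%:E * lebesgue_row (@box R n C))%E.
  rewrite indicE; have [xC|xC] := boolP (_ \in _).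
    rewrite mul1e; congr lebesgue_row; apply/seteqP; split => v /= H i.
      by have := H (rshift 1 i); rewrite row_mxEr.
    case: (split_ordP i) => j ->; rewrite ?row_mxEr// row_mxEl ord1 !mxE mulr1n.
    by move: xC; rewrite inE /= in_itv/= ler_norml.
  rewrite mul0e (_ : [set v | _] = set0)%classic.
    by rewrite lebesgue_rowE preimage_set0 measure0.
  apply/seteqP; split => // v /= H; move/negP: xC; apply; rewrite inE /= in_itv/= -ler_norml.
  by have := H (lshift n 0); rewrite row_mxEl !mxE mulr1n.
under eq_integral do rewrite boxE.
rewrite ge0_integralZr//; last first.
  by apply/measurable_EFinP/measurable_indic; exact: measurable_itv.
rewrite integral_indic// setIT [X in (X * _)%E]lebesgue_measure_itv/= lte_fin.
have : lebesgue_row (@box R n C) \is a fin_num by rewrite ge0_fin_numE// lebesgue_row_ge0.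
case: (lebesgue_row _) => // r _; case: ifP => _; last by rewrite mul0e.
by rewrite -EFinB -EFinM ltry.
Qed.

(** * Volume in affine charts *)

Lemma mrow_flat_chart (R : realType) d n (M : 'M[R]_(d, n)) b A :
  mrow A -> mrow (flat_chart M b @^-1` A).
Proof.
move=> mA; have := mrow_affine M b mA; congr mrow.
by apply/seteqP; split => u /=; rewrite /flat_chart addrC.
Qed.

Lemma flat_chartK (R : realType) d n (M : 'M[R]_(d, n)) b x :
  M *m M^T = 1%:M -> range (flat_chart M b) x ->
  flat_chart M b ((x - b) *m M^T) = x.
Proof.
move=> MM [u _ <-]; rewrite /flat_chart [_ + u *m _]addrC addrK.
by rewrite -[u *m M *m _]mulmxA MM mulmx1 addrC.
Qed.

Lemma flat_chartKV (R : realType) d n (M : 'M[R]_(d, n)) b u :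
  M *m M^T = 1%:M -> (flat_chart M b u - b) *m M^T = u.
Proof. by move=> MM; rewrite /flat_chart [b + _]addrC addrK -mulmxA MM mulmx1. Qed.

(** The difference [x - p] lies in the row space of [M'], hence equals its own orthogonal projection
    onto it. *)
Lemma chart_change (R : realType) d n (M M' : 'M[R]_(d, n)) (b' : 'rV[R]_n)
    (p x : 'rV[R]_n) :
  M *m M^T = 1%:M -> M' *m M'^T = 1%:M ->
  range (flat_chart M' b') p -> range (flat_chart M' b') x ->
  (x - p) *m M^T = (x - p) *m M'^T *m (M' *m M^T).
Proof.
move=> MM MM' Rp Rx.
have {1}-> : x - p = (x - p) *m M'^T *m M'.
  rewrite -{1}(flat_chartK MM' Rx) -{1}(flat_chartK MM' Rp) /flat_chart.
  by rewrite opprD addrACA subrr add0r -mulNmx -mulmxDl -mulNmx -mulmxDl opprB addrA subrK.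
by rewrite !mulmxA.
Qed.

(** With [C = M' *m M^T], passing from the first chart to the second and back shows that the
    coordinates of [x - p] are fixed by [C^T *m C]. If this matrix is not the identity, a nonzero
    column of the difference gives a hyperplane containing the whole chart image. *)
Lemma chart_null (R : realType) d n (M M' : 'M[R]_(d, n)) (b b' : 'rV[R]_n)
    (A : set 'rV[R]_n) (p : 'rV[R]_n) :
  M *m M^T = 1%:M -> M' *m M'^T = 1%:M -> mrow A -> A p ->
  A `<=` range (flat_chart M b) -> A `<=` range (flat_chart M' b') ->
  (M' *m M^T)^T *m (M' *m M^T) != 1%:M ->
  lebesgue_row (flat_chart M b @^-1` A) = 0%E.
Proof.
move=> MM MM' mA Ap AM AM'; set C := M' *m M^T => CC.
have [j Bj] : exists j, col j (C^T *m C - 1%:M) != 0.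
  apply/existsP; apply: contraNT CC; rewrite negb_exists => /forallP c0.
  rewrite -subr_eq0; apply/eqP/matrixP => i j; have := c0 j; rewrite negbK => /eqP/colP/(_ i).
  by rewrite !mxE.
pose w := (col j (C^T *m C - 1%:M))^T.
have w0 : w != 0 by rewrite trmx_eq0.
apply: (@sub_hyperplane_null _ _ w (dotrow w ((p - b) *m M^T)) _ w0); first exact: mrow_flat_chart.
move=> u /= Au; set x := flat_chart M b u in Au.
have uE : u = (x - b) *m M^T by rewrite /x flat_chartKV.
have : (x - p) *m M^T *m (C^T *m C - 1%:M) = 0.
  have CT : C^T = M *m M'^T by rewrite trmx_mul trmxK.
  rewrite mulmxBr mulmx1 mulmxA CT.
  rewrite -(chart_change MM' MM (AM _ Ap) (AM _ Au)).
  by rewrite -(chart_change MM MM' (AM' _ Ap) (AM' _ Au)) subrr.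
move=> /(congr1 (col j)); rewrite colE -mulmxA -colE => wE.
apply/eqP; rewrite -subr_eq0; apply/eqP.
rewrite -dotrowB uE -mulmxBl opprB addrA subrK /dotrow /w trmxK wE.
by rewrite !mxE.
Qed.

(** Either both chart images are null, or the transition matrix is orthogonal and the change of
    charts has determinant of absolute value 1. *)
Lemma lebesgue_row_chart (R : realType) d n (M M' : 'M[R]_(d, n)) (b b' : 'rV[R]_n)
    (A : set 'rV[R]_n) :
  M *m M^T = 1%:M -> M' *m M'^T = 1%:M -> mrow A ->
  A `<=` range (flat_chart M b) -> A `<=` range (flat_chart M' b') ->
  lebesgue_row (flat_chart M b @^-1` A) = lebesgue_row (flat_chart M' b' @^-1` A).
Proof.
move=> MM MM' mA AM AM'.
have [->|/set0P[p Ap]] := eqVneq A set0; first by rewrite !lebesgue_rowE !preimage_set0 !measure0.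
set C := M' *m M^T.
have CT : C^T = M *m M'^T by rewrite trmx_mul trmxK.
have [CC|CC] := eqVneq (C^T *m C) 1%:M; last first.
  rewrite (chart_null MM MM' mA Ap AM AM' CC) (chart_null MM' MM mA Ap AM' AM)//.
  rewrite -CT trmxK; apply: contra_neq CC; exact: mulmx1C.
have Cu : C^T \in unitmx by have [] := mulmx1_unit CC.
have dC : `|\det C^T| = 1.
  have : \det (C^T *m C) = 1 by rewrite CC det1.
  rewrite det_mulmx -[\det C]det_tr -expr2 => /eqP; rewrite sqrf_eq1 => /orP[]/eqP->;
  by rewrite ?normrN normr1.
pose c := (p - b') *m M'^T - (p - b) *m M^T *m C^T.
rewrite -[RHS]mul1e -{1}[1]invr1 -{1}dC -(lebesgue_row_affine c Cu); last exact: mrow_flat_chart.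
congr lebesgue_row; apply/seteqP; split => u /=.
  set x := flat_chart M b u => Ax.
  have uE : u = (x - b) *m M^T by rewrite /x flat_chartKV.
  have -> : u *m C^T + c = (x - b') *m M'^T.
    rewrite /c addrCA -mulmxBl uE -mulmxBl opprB addrA subrK CT.
    rewrite -(chart_change MM' MM (AM _ Ap) (AM _ Ax)).
    by rewrite -mulmxDl addrC addrA subrK.
  by rewrite flat_chartK //; exact: AM'.
set x := flat_chart _ _ _ => Ax.
have xE : u *m C^T + c = (x - b') *m M'^T by rewrite /x flat_chartKV.
have -> : u = (x - b) *m M^T.
  have : (u - (p - b) *m M^T) *m C^T = (x - p) *m M'^T.
    rewrite [LHS]mulmxBl (_ : u *m C^T = (x - b') *m M'^T - c); last by rewrite -xE addrK.
    by rewrite /c opprB addrA addrAC addrK -mulmxBl opprB addrA subrK.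
  move=> /(congr1 (mulmx^~ C)); rewrite -mulmxA CC mulmx1.
  rewrite -(chart_change MM MM' (AM' _ Ap) (AM' _ Ax)).
  by move=> /eqP; rewrite subr_eq -mulmxDl addrA subrK => /eqP.
by rewrite flat_chartK //; exact: AM.
Qed.

Lemma flat_volumeE (R : realType) d n (M : 'M[R]_(d, n)) (b : 'rV[R]_n)
    (A : set 'rV[R]_n) :
  M *m M^T = 1%:M -> mrow A -> A `<=` range (flat_chart M b) ->
  flat_volume d A = lebesgue_row (flat_chart M b @^-1` A).
Proof.
move=> MM mA AM; apply: xget_unique; first by exists M, b.
by move=> v [M' [b' [MM' AM' ->]]]; exact: lebesgue_row_chart.
Qed.

(** Gram-Schmidt, one row at a time: counting ranks leaves a nonzero vector killed by [N] and
    orthogonal to the rows already found, which is then normalised. *)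
Lemma orthonormal_ker (R : realType) d n m (N : 'M[R]_(n, m)) :
  (d + m <= n)%N -> exists M : 'M[R]_(d, n), M *m M^T = 1%:M /\ M *m N = 0.
Proof.
elim: d => [|d IH] dn.
  by exists 0; split; rewrite ?mul0mx //; apply/matrixP => -[].
have [M [MM MN]] := IH (ltnW dn).
have : kermx (row_mx N M^T) != 0.
  rewrite -mxrank_eq0 mxrank_ker subn_eq0 -ltnNge.
  by rewrite (leq_ltn_trans (rank_leq_col _))// addnC.
move=> /rowV0Pn[v /sub_kermxP]; rewrite mul_mx_row => /eqP.
rewrite row_mx_eq0 => /andP[/eqP vN /eqP vM] v0.
pose s := \sum_i v 0 i ^+ 2.
have s0 : 0 < s.
  rewrite lt_neqAle eq_sym sumr_ge0 => [|i _]; last exact: sqr_ge0.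
  rewrite andbT; apply: contraNneq v0 => /eqP; rewrite psumr_eq0 => [|i _]; last exact: sqr_ge0.
  move=> /allP H; apply/eqP/rowP => i; rewrite mxE; apply/eqP.
  by have := H i (mem_index_enum i); rewrite sqrf_eq0.
have vv : v *m v^T = s%:M.
  by rewrite [LHS]mx11_scalar mxE; congr _%:M; apply: eq_bigr => i _; rewrite mxE expr2.
pose r := (Num.sqrt s)^-1.
have Mv : M *m v^T = 0 by rewrite -[M *m _]trmxK trmx_mul trmxK vM trmx0.
rewrite -[d.+1]/(1 + d)%N; exists (col_mx (r *: v) M); split.
  rewrite tr_col_mx mul_col_row MM linearZ /= -!scalemxAr -!scalemxAl vM Mv vv.
  rewrite !scaler0 scalerA scale_scalar_mx (_ : r * r * s = 1) ?scalar_mx_block//.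
  by rewrite -{1}(sqr_sqrtr (ltW s0)) expr2 /r; field; rewrite gt_eqF// sqrtr_gt0.
by rewrite mul_col_mx MN -scalemxAl vN scaler0 col_mx0.
Qed.

(** * Faces of generalized permutahedra *)

(** The blocks become the fibres of a surjection [blk], so that sums over blocks are filtered sums
    over ['I_n]. *)
Lemma ordered_partition_block (n k : nat) (pi : 'I_k -> {set 'I_n}) :
  ordered_partition pi -> exists blk : 'I_n -> 'I_k,
    (forall s, exists i, blk i = s) /\
    pi = (fun s => [set i | blk i == s]%SET).
Proof.
move=> [pi_inj /and3P[/eqP covT trivP P0]].
have uniq_blk i s t : i \in pi s -> i \in pi t -> s = t.
  move=> i_s i_t; apply: pi_inj.
  have piP u : pi u \in [set pi s | s : 'I_k]%SET by exact: imset_f.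
  by rewrite -(def_pblock trivP (piP s) i_s) (def_pblock trivP (piP t) i_t).
have ex_blk i : exists s, i \in pi s.
  have : i \in finset.cover [set pi s | s : 'I_k]%SET by rewrite covT inE.
  by move=> /bigcupP[_ /imsetP[s _ ->] ?]; exists s.
have [blk blkP] := choice ex_blk.
exists blk; split => [s|].
  have /set0Pn[i is_] : pi s != finset.set0.
    by apply: contraNneq P0 => <-; exact: imset_f.
  by exists i; apply: uniq_blk is_.
apply/funext => s; apply/setP => i; rewrite inE; apply/idP/eqP => [|<-//].
exact: uniq_blk.
Qed.

Lemma first_blocksE (n k : nat) (blk : 'I_n -> 'I_k) r :
  first_blocks (fun s => [set i | blk i == s]%SET) r = [set i | (blk i < r)%N]%SET.
Proof.
apply/setP => i; rewrite inE; apply/bigcupP/idP => [[s sr]|ir].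
  by rewrite inE => /eqP ->.
by exists (blk i) => //; rewrite inE.
Qed.

(** Each coordinate is the marginal increase of [z] when its index is added in the order of [rk].
    Tightness telescopes, and supermodularity yields the remaining inequalities by induction on the
    rank. *)
Lemma greedy_point (R : realType) (n : nat) (z : {set 'I_n} -> R) (rk : 'I_n -> nat) :
  z finset.set0 = 0 -> supermodular z -> injective rk ->
  exists2 g, polytope_of z g &
    forall m, \sum_(i | (rk i < m)%N) g 0 i = z [set i | (rk i < m)%N]%SET.
Proof.
move=> z0 z_super rk_inj.
pose pre m := [set i | (rk i < m)%N]%SET.
pose g : 'rV[R]_n := \row_i (z (pre (rk i).+1) - z (pre (rk i))).
have pre0 : pre 0%N = finset.set0 by apply/setP => i; rewrite !inE.
(* Ranks need not be consecutive, so a step may add no index. *)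
have preS m : (exists i, rk i = m) \/ pre m.+1 = pre m.
  have [[i im]|/forallNP noi] := pselect (exists i, rk i = m); first by left; exists i.
  right; apply/setP => i; rewrite !inE ltnS leq_eqVlt; case: eqVneq => //= im.
  by case: (noi i).
have tight m : \sum_(i | (rk i < m)%N) g 0 i = z (pre m).
  elim: m => [|m IH]; first by rewrite pre0 z0 big_pred0.
  case: (preS m) => [[i im]|preE]; last first.
    rewrite preE -IH; apply: eq_bigl => i.
    by have /setP/(_ i) := preE; rewrite !inE.
  rewrite (bigD1 i)/= ?im// mxE im (eq_bigl (fun j => rk j < m)%N) ?IH ?subrK//.
  move=> j; rewrite ltnS ltn_neqAle andbC -im; congr (_ && _).
  by rewrite (inj_eq rk_inj).
have lower (I : {set 'I_n}) m :
    z (I :&: pre m)%SET <= \sum_(i | (i \in I) && (rk i < m)%N) g 0 i.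
  elim: m => [|m IH]; first by rewrite pre0 finset.setI0 z0 big_pred0// => i; rewrite andbF.
  case: (preS m) => [[i im]|preE]; last first.
    rewrite preE; apply: le_trans IH _; rewrite le_eqVlt; apply/orP; left; apply/eqP.
    by apply: eq_bigl => i; have /setP/(_ i) := preE; rewrite !inE => ->.
  have rkS j : (rk j < m.+1)%N && (j != i) = (rk j < m)%N.
    by rewrite ltnS ltn_neqAle andbC -im (inj_eq rk_inj).
  have [iI|iI] := boolP (i \in I); last first.
    rewrite (_ : I :&: pre m.+1 = I :&: pre m)%SET; last first.
      apply/setP => j; rewrite !inE -rkS; case: eqVneq => [->|]; last by rewrite andbT.
      by rewrite (negbTE iI).
    apply: le_trans IH _; rewrite le_eqVlt; apply/orP; left; apply/eqP.
    apply: eq_bigl => j; rewrite -rkS; case: eqVneq => [->|]; last by rewrite andbT.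
    by rewrite (negbTE iI).
  rewrite (bigD1 i)/= ?im ?iI ?leqnn//.
  rewrite (eq_bigl (fun j => (j \in I) && (rk j < m)%N)); last first.
    by move=> j; rewrite -andbA rkS.
  rewrite mxE im.
  (* These two sets have union [pre m.+1] and intersection [I :&: pre m]: adding [i] to the smaller
     set increases [z] by at most the coordinate [g 0 i]. *)
  have := z_super (I :&: pre m.+1)%SET (pre m).
  have -> : ((I :&: pre m.+1) :|: pre m)%SET = pre m.+1.
    apply/setP => j; rewrite !inE -rkS; case: eqVneq => [->|_]; rewrite ?iI ?andbT ?andbF ?orbF//.
    by case: (rk j < m.+1)%N; rewrite ?andbT ?orbT ?andbF.
  have -> : (I :&: pre m.+1 :&: pre m)%SET = (I :&: pre m)%SET.
    apply/setP => j; rewrite !inE -rkS; case: (j \in I) => //=.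
    by case: (rk j < m.+1)%N => //=; rewrite andbT.
  lra.
pose N := (\max_i rk i).+1.
have rkN i : (rk i < N)%N by rewrite ltnS leq_bigmax.
have preN : pre N = [set: 'I_n]%SET by apply/setP => i; rewrite !inE rkN.
exists g; last exact: tight.
split=> [|I]; first by rewrite -preN -tight; apply: eq_bigl => i; rewrite rkN.
rewrite -[X in z X]finset.setIT -preN; apply: le_trans (lower I N) _.
by rewrite le_eqVlt; apply/orP; left; apply/eqP/eq_bigl => i; rewrite rkN andbT.
Qed.

(** Summation by parts; it will express a linear functional through the slacks of the constraints on
    initial unions of blocks. *)
Lemma abel_sum (R : realType) (al de : nat -> R) k : de 0%N = 0 ->
  \sum_(s < k.+1) al s * (de s.+1 - de s) =
  al k * de k.+1 - \sum_(s < k) (al s.+1 - al s) * de s.+1.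
Proof.
move=> d0; elim: k => [|k IH]; first by rewrite big_ord_recr !big_ord0/= d0 subr0 subr0 add0r.
by rewrite big_ord_recr IH [in RHS]big_ord_recr /=; ring.
Qed.

Lemma sum_ltnS_block (R : realType) n k (blk : 'I_n -> 'I_k) (P : pred 'I_n)
    (s : nat) (t : 'I_n -> R) :
  \sum_(i | P i && (blk i < s.+1)%N) t i =
  \sum_(i | P i && (blk i < s)%N) t i + \sum_(i | P i && (blk i == s :> nat)) t i.
Proof.
rewrite (bigID (fun i => (blk i < s)%N))/=; congr +%R; apply: eq_bigl => i.
  by rewrite ltnS -andbA; congr andb; case: ltngtP.
by rewrite ltnS -andbA; congr andb; case: ltngtP.
Qed.

Definition tight_face (R : realType) n k (z : {set 'I_n} -> R) (blk : 'I_n -> 'I_k) :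
    set 'rV[R]_n :=
  [set t | polytope_of z t /\
    forall r, \sum_(i | (blk i < r)%N) t 0 i = z [set i | (blk i < r)%N]%SET].

Lemma tight_face_neq0 (R : realType) n k (z : {set 'I_n} -> R) (blk : 'I_n -> 'I_k) :
  z finset.set0 = 0 -> supermodular z -> exists g, tight_face z blk g.
Proof.
move=> z0 z_super.
(* Lexicographic rank, block first and index second: the first [r] blocks are exactly the indices of
   rank below [r * n]. *)
pose rk i := (blk i * n + i)%N.
have divrk i : (rk i %/ n)%N = blk i.
  have n0 : (0 < n)%N by apply: leq_ltn_trans (ltn_ord i).
  by rewrite /rk divnMDl// divn_small ?addn0.
have rk_inj : injective rk.
  move=> i j ij; apply/val_inj; move: (ij); rewrite /rk => /eqP.
  by rewrite -(divrk i) ij divrk eqn_add2l => /eqP.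
have [g Pg g_tight] := greedy_point z0 z_super rk_inj.
exists g; split=> // r; have rkE i : (rk i < r * n)%N = (blk i < r)%N.
  have n0 : (0 < n)%N by apply: leq_ltn_trans (ltn_ord i).
  by rewrite -ltn_divLR// divrk.
have := g_tight (r * n)%N; rewrite (eq_bigl _ _ rkE) => ->.
by congr z; apply/setP => i; rewrite !inE rkE.
Qed.

Lemma dotv_sum_blocks (R : realType) n k (blk : 'I_n -> 'I_k) (a : 'rV[R]_n)
    (al : nat -> R) (t : 'rV[R]_n) : (forall i, a 0 i = al (blk i)) ->
  dotv a t = \sum_(s < k) al s * (\sum_(i | (blk i < s.+1)%N) t 0 i -
                                  \sum_(i | (blk i < s)%N) t 0 i).
Proof.
move=> aE; rewrite /dotv (partition_big blk xpredT)//=; apply: eq_bigr => s _.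
rewrite (sum_ltnS_block blk xpredT s (t 0)) addrC addKr mulr_sumr.
by apply: eq_big => [//|i /eqP <-]; rewrite aE.
Qed.

(** Relative to a tight point [g], the functional equals minus a combination of the slacks [de],
    which are nonnegative, with the positive jumps of [a] between consecutive blocks as
    coefficients. It is maximal exactly when all slacks vanish. *)
Lemma max_face_tight (R : realType) n k (z : {set 'I_n} -> R) (blk : 'I_n -> 'I_k)
    (a : 'rV[R]_n) :
  z finset.set0 = 0 -> supermodular z -> (forall s, exists i, blk i = s) ->
  has_type (fun s => [set i | blk i == s]%SET) a ->
  max_face (polytope_of z) a = tight_face z blk.
Proof.
move=> z0 z_super blk_surj [a_eq a_lt].
have [g [Pg g_tight]] := tight_face_neq0 blk z0 z_super.
have [f fK] := choice blk_surj.
(* The common value of [a] on block [r]; the jumps used below only involve indices less than [k],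
   away from the default 0. *)
pose al r := if insub r is Some s then a 0 (f s) else 0.
have alE s : al (val s) = a 0 (f s) by rewrite /al valK.
have aE i : a 0 i = al (blk i).
  by rewrite alE; apply/a_eq; exists (blk i); rewrite !inE fK eqxx.
pose de t r := \sum_(i | (blk i < r)%N) (t : 'rV[R]_n) 0 i - z [set i | (blk i < r)%N]%SET.
have de_ge0 t r : polytope_of z t -> 0 <= de t r.
  move=> [_ /(_ [set i | (blk i < r)%N]%SET)]; rewrite subr_ge0; congr (_ <= _).
  by apply: eq_bigl => i; rewrite inE.
have de0 t : de t 0%N = 0.
  rewrite /de big_pred0// (_ : [set i | _]%SET = finset.set0) ?z0 ?subrr//.
have dek t r : polytope_of z t -> (k <= r)%N -> de t r = 0.
  move=> [Pt _] kr; have ltr i : (blk i < r)%N by apply: leq_trans (ltn_ord _) kr.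
  rewrite /de (eq_bigl xpredT)// Pt (_ : [set i | _]%SET = [set: 'I_n]%SET) ?subrr//.
  by apply/setP => i; rewrite !inE ltr.
have dotE t : dotv a t - dotv a g = \sum_(s < k) al s * (de t s.+1 - de t s).
  rewrite !(dotv_sum_blocks _ aE) -sumrB; apply: eq_bigr => s _.
  by rewrite -mulrBr /de !g_tight; congr (_ * _); ring.
have dotE' t : polytope_of z t -> dotv a t - dotv a g =
    - \sum_(s < k.-1) (al s.+1 - al s) * de t s.+1.
  move=> Pt; rewrite dotE; case: (k) dek => [|k'] dek; first by rewrite !big_ord0 oppr0.
  by rewrite abel_sum// dek// mulr0 sub0r.
have term_ge0 t (s : 'I_k.-1) : polytope_of z t ->
    (0 < al s.+1 - al s) /\ 0 <= (al s.+1 - al s) * de t s.+1.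
  move=> Pt; have sk : (s.+1 < k)%N by move: (ltn_ord s); rewrite ltn_predRL.
  have pos : 0 < al s.+1 - al s.
    rewrite subr_gt0 (alE (Ordinal (ltnW sk))) (alE (Ordinal sk)).
    by apply: (a_lt (Ordinal (ltnW sk)) (Ordinal sk)); rewrite ?inE ?fK.
  by split=> //; rewrite mulr_ge0 ?de_ge0// ltW.
apply/seteqP; split => t.
  move=> [Pt tmax]; split=> // r.
  have := tmax g Pg; rewrite -subr_ge0 dotE'// oppr_ge0 => le0.
  have /eqP : \sum_(s < k.-1) (al s.+1 - al s) * de t s.+1 = 0.
    apply/le_anti; rewrite le0 sumr_ge0// => s _; exact: (term_ge0 t s Pt).2.
  rewrite psumr_eq0 => [/allP H|s _]; last exact: (term_ge0 t s Pt).2.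
  apply/eqP; rewrite -subr_eq0 -/(de t r).
  case: r => [|r]; first by rewrite de0.
  have [kr|rk] := leqP k r.+1; first by rewrite dek.
  have rk1 : (r < k.-1)%N by rewrite ltn_predRL.
  have := H (Ordinal rk1) (mem_index_enum _); rewrite mulf_eq0 => /orP[|//].
  by rewrite gt_eqF// (term_ge0 t (Ordinal rk1) Pt).1.
move=> [Pt t_tight]; split=> // y Py; rewrite -(lerD2r (- dotv a g)).
rewrite !dotE'// lerN2 big1 => [|s _]; last by rewrite /de t_tight subrr mulr0.
by apply: sumr_ge0 => s _; exact: (term_ge0 y s Py).2.
Qed.

(* For fixed s these are the supermodular parameters of the s-th factor of the
   face, which is a product of one generalized permutahedron per block. *)
Definition block_param (R : realType) n k (z : {set 'I_n} -> R) (blk : 'I_n -> 'I_k)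
    (s : 'I_k) (I : {set 'I_n}) : R :=
  z ([set i in I | blk i == s] :|: [set i | (blk i < s)%N])%SET -
  z [set i | (blk i < s)%N]%SET.

(** The height [block_height] expressed through [blk]. *)
Definition level (R : realType) n k (z : {set 'I_n} -> R) (blk : 'I_n -> 'I_k)
    (s : 'I_k) : R :=
  z [set i | (blk i < s.+1)%N]%SET - z [set i | (blk i < s)%N]%SET.

(** The product structure of the face. Forwards, the constraint for part of block [s] together with
    all earlier blocks is compared with the tight one; backwards, the constraints of the blocks are
    added up in order, using supermodularity at each block. *)
Lemma tight_faceP (R : realType) n k (z : {set 'I_n} -> R) (blk : 'I_n -> 'I_k) t :
  z finset.set0 = 0 -> supermodular z ->
  tight_face z blk t <->
  (forall s, \sum_(i | blk i == s) t 0 i = level z blk s) /\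
  (forall s (I : {set 'I_n}), block_param z blk s I <= \sum_(i | (i \in I) && (blk i == s)) t 0 i).
Proof.
move=> z0 z_super; split=> [[[Pt t_ge] tight]|[t_eq t_ge]].
  split=> [s|s I].
    rewrite /level -!tight (sum_ltnS_block blk xpredT s (t 0)) addrC addKr.
    exact: eq_bigl.
  rewrite /block_param lerBlDr -tight; apply: le_trans (t_ge _) _.
  rewrite (bigID (fun i => (blk i < s)%N))/= addrC le_eqVlt; apply/orP; left; apply/eqP.
  congr +%R; apply: eq_bigl => i; rewrite !inE.
    by rewrite -val_eqE; case: ltngtP; rewrite ?andbF ?andbT ?orbF.
  by case: (blk i < s)%N; rewrite ?orbT ?andbF.
have tight r : \sum_(i | (blk i < r)%N) t 0 i = z [set i | (blk i < r)%N]%SET.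
  elim: r => [|r IH].
    rewrite big_pred0// (_ : [set i | _]%SET = finset.set0) ?z0//.
  have [rk|kr] := ltnP r k.
    rewrite (sum_ltnS_block blk xpredT r (t 0)) IH.
    have := t_eq (Ordinal rk); rewrite /level /= => e.
    rewrite (eq_bigl (fun i => blk i == Ordinal rk)) ?e 1?addrC ?subrK//.
  have bE i : (blk i < r.+1)%N = (blk i < r)%N.
    by have := leq_trans (ltn_ord (blk i)) kr => lt; rewrite ltnS lt (ltnW lt).
  rewrite (eq_bigl _ _ bE) IH; congr z; apply/setP => i; by rewrite !inE bE.
have lower (I : {set 'I_n}) r :
    z (I :&: [set i | (blk i < r)%N])%SET <= \sum_(i | (i \in I) && (blk i < r)%N) t 0 i.
  elim: r => [|r IH].
    rewrite big_pred0 => [|i]; last by rewrite andbF.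
    rewrite (_ : (_ :&: _)%SET = finset.set0) ?z0//.
    by apply/setP => i; rewrite !inE andbF.
  have [rk|kr] := ltnP r k; last first.
    have bE i : (blk i < r.+1)%N = (blk i < r)%N.
      by have := leq_trans (ltn_ord (blk i)) kr => lt; rewrite ltnS lt (ltnW lt).
    rewrite (eq_bigl (fun i => (i \in I) && (blk i < r)%N)) => [|i]; last by rewrite bE.
    rewrite (_ : (_ :&: _)%SET = (I :&: [set i | (blk i < r)%N])%SET)//.
    by apply/setP => i; rewrite !inE bE.
  rewrite (sum_ltnS_block blk (mem I) r (t 0)).
  have := t_ge (Ordinal rk) I; rewrite /block_param /=.
  rewrite (eq_bigl (fun i => (i \in I) && (blk i == r :> nat)))//.
  have := z_super (I :&: [set i | (blk i < r.+1)%N])%SET [set i | (blk i < r)%N]%SET.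
  rewrite (_ : (I :&: [set i | (blk i < r.+1)%N] :|: _)%SET =
     ([set i in I | blk i == Ordinal rk] :|: [set i | (blk i < r)%N])%SET); last first.
    apply/setP => i; rewrite !inE -val_eqE /= ltnS leq_eqVlt.
    by case: (i \in I); rewrite //= -orbA orbb.
  rewrite (_ : (I :&: [set i | (blk i < r.+1)%N] :&: _)%SET =
     (I :&: [set i | (blk i < r)%N])%SET); last first.
    apply/setP => i; rewrite !inE -andbA; congr andb.
    by rewrite andb_idl// => /ltnW; rewrite ltnS.
  lra.
have ltk i : (blk i < k)%N by [].
have preT : [set i | (blk i < k)%N]%SET = [set: 'I_n]%SET.
  by apply/setP => i; rewrite !inE ltk.
split=> //; split.
  by rewrite -preT -tight; apply: eq_bigl => i; rewrite ltk.
move=> I; have := lower I k; rewrite preT finset.setIT; congr (_ <= _).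
by apply: eq_bigl => i; rewrite ltk andbT.
Qed.

(** * The lifting as a polyhedron *)

Lemma convex_setP (R : realType) n (A : set 'rV[R]_n) :
  @convex_set R 'rV[R]_n A <->
  (forall x y l, 0 <= l <= 1 -> A x -> A y -> A (l *: x + (1 - l) *: y)).
Proof.
split=> [cA x y l /andP[l0 l1] Ax Ay|cA x y l].
  by have := cA x y (Itv01 l0 l1); rewrite !inE; apply.
rewrite !inE => Ax Ay.
by apply: (cA x y l%:inum) => //; apply/andP; split.
Qed.

(** The last point is split off and the other weights are renormalised by their sum [S]; if that sum
    is zero, only the last point remains. *)
Lemma convex_combination (R : realType) n (A : set 'rV[R]_n) m (l : nat -> R)
    (x : nat -> 'rV[R]_n) : @convex_set R 'rV[R]_n A ->
  (forall i, (i < m)%N -> 0 <= l i) -> (forall i, (i < m)%N -> A (x i)) ->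
  \sum_(i < m) l i = 1 -> A (\sum_(i < m) l i *: x i).
Proof.
move=> /convex_setP cA; elim: m l => [l _ _|m IH l l0 Ax].
  by rewrite big_ord0 => /esym/eqP; rewrite oner_eq0.
rewrite !big_ord_recr/= => l1.
have Sl0 : 0 <= \sum_(i < m) l i by apply: sumr_ge0 => i _; apply: l0; exact: leqW.
have [S0|S0] := eqVneq (\sum_(i < m) l i) 0.
  have l_eq0 (i : 'I_m) : l i = 0.
    move/eqP: S0; rewrite psumr_eq0 => [/allP/(_ i (mem_index_enum i))/eqP//|j _].
    by apply: l0; exact: leqW.
  rewrite big1 => [|i _]; last by rewrite l_eq0 scale0r.
  by move: l1; rewrite S0 !add0r => ->; rewrite scale1r; exact: Ax.
set S := \sum_(i < m) l i in l1 Sl0 S0.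
have -> : \sum_(i < m) l i *: x i = S *: (\sum_(i < m) (l i / S) *: x i).
  rewrite scaler_sumr; apply: eq_bigr => i _.
  by rewrite scalerA mulrC divfK.
have -> : l m = 1 - S by move: l1; lra.
apply: cA; [|apply: (IH (fun i => l i / S))|exact: Ax].
- by rewrite Sl0/= -l1 lerDl l0.
- by move=> i im; rewrite divr_ge0// l0// leqW.
- by move=> i im; apply: Ax; exact: leqW.
- by rewrite -mulr_suml mulfV.
Qed.

(** The factor by which block [s] of a point of the face must have been scaled to give block [s] of
    [y]. *)
Definition block_ratio (R : realType) n k (z : {set 'I_n} -> R) (blk : 'I_n -> 'I_k)
    (s : 'I_k) (y : 'rV[R]_n) : R :=
  (\sum_(i | blk i == s) y 0 i) / level z blk s.

(** The face constraints are homogenised by the ratios, which makes all conditions linear in [y]. *)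
Definition lift_poly (R : realType) n k (z : {set 'I_n} -> R) (blk : 'I_n -> 'I_k)
    (q : R) : set 'rV[R]_n :=
  [set y | [/\ forall s, q <= block_ratio z blk s y <= 1,
     forall s t : 'I_k, (s <= t)%N -> block_ratio z blk s y <= block_ratio z blk t y &
     forall s (I : {set 'I_n}), block_ratio z blk s y * block_param z blk s I <=
        \sum_(i | (i \in I) && (blk i == s)) y 0 i]].

Definition scale_blocks (R : realType) n k (blk : 'I_n -> 'I_k) (rho : 'I_k -> R)
    (x : 'rV[R]_n) : 'rV[R]_n := \row_i (rho (blk i) * x 0 i).

Lemma sum_scale_blocks (R : realType) n k (blk : 'I_n -> 'I_k) (rho : 'I_k -> R)
    (x : 'rV[R]_n) (P : pred 'I_n) s :
  \sum_(i | P i && (blk i == s)) scale_blocks blk rho x 0 i =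
  rho s * \sum_(i | P i && (blk i == s)) x 0 i.
Proof.
by rewrite mulr_sumr; apply: eq_bigr => i /andP[_ /eqP <-]; rewrite mxE.
Qed.

Lemma block_ratio_scale (R : realType) n k (z : {set 'I_n} -> R) (blk : 'I_n -> 'I_k)
    (rho : 'I_k -> R) (x : 'rV[R]_n) s :
  z finset.set0 = 0 -> supermodular z -> 0 < level z blk s ->
  tight_face z blk x -> block_ratio z blk s (scale_blocks blk rho x) = rho s.
Proof.
move=> z0 z_super h0 /(tight_faceP _ _ z0 z_super)[xs _].
by rewrite /block_ratio (sum_scale_blocks _ _ _ xpredT)/= xs mulfK// gt_eqF.
Qed.

Lemma scale_blocks_lift_poly (R : realType) n k (z : {set 'I_n} -> R)
    (blk : 'I_n -> 'I_k) (q : R) (rho : 'I_k -> R) (x : 'rV[R]_n) :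
  z finset.set0 = 0 -> supermodular z -> (forall s, 0 < level z blk s) ->
  0 <= q -> tight_face z blk x ->
  (forall s, q <= rho s <= 1) -> (forall s t : 'I_k, (s <= t)%N -> rho s <= rho t) ->
  lift_poly z blk q (scale_blocks blk rho x).
Proof.
move=> z0 z_super h0 q0 Fx rho01 rho_mono.
have rE s : block_ratio z blk s (scale_blocks blk rho x) = rho s by exact: block_ratio_scale.
split=> [s|s t st|s I]; rewrite !rE//; first exact: rho_mono.
have [_ x_ge] := (tight_faceP blk x z0 z_super).1 Fx.
rewrite sum_scale_blocks ler_wpM2l//.
by have /andP[/(le_trans q0)] := rho01 s.
Qed.

(** Each block is divided by its ratio. A block of ratio 0, which can occur only for [q = 0], is
    filled in from an arbitrary point [x0] of the face. *)
Lemma lift_poly_scale_blocks (R : realType) n k (z : {set 'I_n} -> R)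
    (blk : 'I_n -> 'I_k) (q : R) (y : 'rV[R]_n) :
  z finset.set0 = 0 -> supermodular z -> (forall s, 0 < level z blk s) ->
  0 <= q -> lift_poly z blk q y ->
  exists2 x, tight_face z blk x & y = scale_blocks blk (fun s => block_ratio z blk s y) x.
Proof.
move=> z0 z_super h0 q0 [r01 _ y_ge].
have r_ge0 s : 0 <= block_ratio z blk s y by have /andP[/(le_trans q0)] := r01 s.
have [x0 Fx0] := tight_face_neq0 blk z0 z_super.
have [x0s x0_ge] := (tight_faceP blk x0 z0 z_super).1 Fx0.
have sumE s : \sum_(i | blk i == s) y 0 i = block_ratio z blk s y * level z blk s.
  by rewrite /block_ratio divfK// gt_eqF.
pose x : 'rV[R]_n := \row_i (if block_ratio z blk (blk i) y == 0 then x0 0 i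
                             else y 0 i / block_ratio z blk (blk i) y).
have xE (P : pred 'I_n) s : \sum_(i | P i && (blk i == s)) x 0 i =
    if block_ratio z blk s y == 0 then \sum_(i | P i && (blk i == s)) x0 0 i
    else (\sum_(i | P i && (blk i == s)) y 0 i) / block_ratio z blk s y.
  case: ifP => r0; rewrite ?mulr_suml; apply: eq_bigr => i /andP[_ /eqP bi];
    by rewrite mxE bi r0.
exists x.
  apply/(tight_faceP _ _ z0 z_super); split=> [s|s I].
    rewrite (xE xpredT); case: eqVneq => [_|r0]; first exact: x0s.
    by rewrite /= sumE mulrC mulKf.
  rewrite (xE (mem I)); case: eqVneq => [_|r0]; first exact: x0_ge.
  by rewrite ler_pdivlMr ?lt_neqAle 1?eq_sym ?r0 ?r_ge0// mulrC.
apply/rowP => i; rewrite !mxE; case: eqVneq => [r0|r0]; last by rewrite mulrC divfK.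
rewrite r0 mul0r.
(* In a block of ratio 0 the singleton constraints make the entries nonnegative; as they sum to 0,
   they all vanish. *)
have y_ge0 j : blk j == blk i -> 0 <= y 0 j.
  move=> /eqP ji; have := y_ge (blk i) [set j]%SET.
  rewrite r0 mul0r (eq_bigl (pred1 j)) ?big_pred1_eq// => l.
  by rewrite inE /=; case: eqVneq => [->|//]; rewrite ji eqxx.
have /eqP := sumE (blk i); rewrite r0 mul0r psumr_eq0// => /allP/(_ i (mem_index_enum i)).
by rewrite eqxx => /eqP.
Qed.

Lemma lift_poly_convex (R : realType) n k (z : {set 'I_n} -> R)
    (blk : 'I_n -> 'I_k) (q : R) : @convex_set R 'rV[R]_n (lift_poly z blk q).
Proof.
apply/convex_setP => x y l /andP[l0 l1] [x1 x2 x3] [y1 y2 y3].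
have l1' : 0 <= 1 - l by rewrite subr_ge0.
have sE P : \sum_(i | P i) (l *: x + (1 - l) *: y) 0 i =
    l * (\sum_(i | P i) x 0 i) + (1 - l) * \sum_(i | P i) y 0 i.
  by rewrite !mulr_sumr -big_split; apply: eq_bigr => i _; rewrite !mxE.
have rE s : block_ratio z blk s (l *: x + (1 - l) *: y) =
    l * block_ratio z blk s x + (1 - l) * block_ratio z blk s y.
  by rewrite /block_ratio sE mulrDl !mulrA.
split=> [s|s t st|s I]; rewrite ?rE ?sE.
- have /andP[? ?] := x1 s; have /andP[? ?] := y1 s.
  have convE (c : R) : c = l * c + (1 - l) * c by ring.
  by apply/andP; split; [rewrite [leLHS]convE|rewrite [leRHS]convE]; rewrite lerD// ler_wpM2l.
- by apply: lerD; apply: ler_wpM2l => //; [exact: x2|exact: y2].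
- by rewrite mulrDl -(mulrA l) -(mulrA (1 - l)); apply: lerD; apply: ler_wpM2l => //.
Qed.

Lemma scale_coordsE (R : realType) n k (blk : 'I_n -> 'I_k) (q : R) r (x : 'rV[R]_n) :
  scale_coords q (first_blocks (fun s => [set i | blk i == s]%SET) r) x =
  scale_blocks blk (fun s => if (s < r)%N then q else 1) x.
Proof.
by apply/rowP => i; rewrite !mxE first_blocksE inE; case: ifP => // _; rewrite mul1r.
Qed.

(** The weights are the increments of the sequence [q], the values of [rho], then 1, divided by the
    total increase [1 - q]. *)
Lemma monotone_weights (R : realType) k (q : R) (rho : 'I_k -> R) :
  q < 1 -> (forall s, q <= rho s <= 1) -> (forall s t : 'I_k, (s <= t)%N -> rho s <= rho t) ->
  exists l : nat -> R, [/\ forall r, (r < k.+1)%N -> 0 <= l r,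
    \sum_(r < k.+1) l r = 1 &
    forall s : 'I_k, \sum_(r < k.+1) l r * (if (s < r)%N then q else 1) = rho s].
Proof.
move=> q1 rho01 rho_mono.
pose e r := if r is r'.+1 then (if insub r' is Some s then rho s else 1) else q.
have eS (s : 'I_k) : e s.+1 = rho s by rewrite /e valK.
have ek r : (k <= r)%N -> e r.+1 = 1 by move=> kr; rewrite /e insubF// ltnNge kr.
have q0 : 1 - q != 0 by rewrite subr_eq0 gt_eqF.
exists (fun r => (e r.+1 - e r) / (1 - q)).
have tel m : \sum_(r < m) (e r.+1 - e r) = e m - q.
  by rewrite -(big_mkord xpredT (fun r => e r.+1 - e r)) telescope_sumr.
have sum1 : \sum_(r < k.+1) (e r.+1 - e r) / (1 - q) = 1.
  by rewrite -mulr_suml tel ek// mulfV.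
split=> // [r rk|s].
  rewrite divr_ge0 ?subr_ge0 ?(ltW q1)//.
  have [kr|rk'] := leqP k r.
    rewrite ek//; case: r {rk} kr => [|r] kr; first exact: ltW.
    have [kr'|rk'] := leqP k r; first by rewrite ek.
    by rewrite (eS (Ordinal rk')); case/andP: (rho01 (Ordinal rk')).
  rewrite (eS (Ordinal rk')); case: r {rk} rk' => [|r] rk'.
    by case/andP: (rho01 (Ordinal rk')).
  by rewrite (eS (Ordinal (ltnW rk'))) rho_mono//=.
(* Every weight contributes at least its multiple by [q]; those with [r <= s] contribute [1 - q]
   times the weight in addition, and these extras telescope to [rho s - q]. *)
transitivity (q * \sum_(r < k.+1) (e r.+1 - e r) / (1 - q) +
    \sum_(r < k.+1 | (r < s.+1)%N) (e r.+1 - e r)).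
  rewrite mulr_sumr [X in _ = _ + X]big_mkcond -big_split; apply: eq_bigr => r _ /=.
  by move: (e r.+1) (e r) => E1 E2; rewrite ltnS; case: ltnP => _; field.
rewrite sum1 mulr1 -(big_ord_widen _ (fun r => e r.+1 - e r)) ?ltnS 1?ltnW//.
by rewrite tel eS addrC subrK.
Qed.

(** The polyhedron is convex and contains the scaled faces. Conversely, each of its points is a
    convex combination of the [k.+1] scaled copies of a single point [x] of the face. *)
Lemma liftingE (R : realType) n k (z : {set 'I_n} -> R) (blk : 'I_n -> 'I_k) (q : R) :
  z finset.set0 = 0 -> supermodular z -> (forall s, 0 < level z blk s) ->
  0 <= q <= 1 ->
  lifting (fun s => [set i | blk i == s]%SET) q (tight_face z blk) = lift_poly z blk q.
Proof.
move=> z0 z_super h0 /andP[q0 q1]; apply/seteqP; split.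
  apply: smallest_sub; first exact: lift_poly_convex.
  move=> _ [r _ [x Fx <-]]; rewrite scale_coordsE; apply: scale_blocks_lift_poly => //.
    by move=> s; case: ifP; rewrite ?lexx ?q1.
  move=> s t st; case: ifPn => sr; case: ifPn => tr //.
  by rewrite (leq_ltn_trans st tr) in sr.
move=> y Ly C [cC sub]; have [x Fx yE] := lift_poly_scale_blocks z0 z_super h0 q0 Ly.
have [r01 r_mono _] := Ly.
have Cx r : (r <= k)%N -> C (scale_blocks blk (fun s => if (s < r)%N then q else 1) x).
  by move=> rk; apply: sub; exists r => //; exists x => //; rewrite scale_coordsE.
(* For [q = 1] the weights would divide by zero, but then all ratios are 1 and [y] is [x] itself. *)
have [q_eq1|q_neq1] := eqVneq q 1.
  have := Cx 0%N isT; congr C; rewrite yE; apply/rowP => i; rewrite !mxE /=.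
  congr (_ * _); by have := r01 (blk i); rewrite q_eq1 => /le_anti.
have q_lt1 : q < 1 by rewrite lt_neqAle q_neq1.
have [l [l0 l1 lE]] := monotone_weights q_lt1 r01 r_mono.
have := @convex_combination _ _ C k.+1 l
  (fun r => scale_blocks blk (fun s => if (s < r)%N then q else 1) x) cC l0 Cx l1.
congr C; rewrite [RHS]yE; apply/rowP => i; rewrite summxE [RHS]mxE -lE mulr_suml.
by apply: eq_bigr => r _; rewrite !mxE mulrA.
Qed.

(** * Iterated integrals *)

Lemma integral_deriv_poly (R : realType) (F : {poly R}) (q u : R) : q <= u ->
  (\int[lebesgue_measure]_(t in `[q, u]) (F^`().[t])%:E = (F.[u] - F.[q])%:E)%E.
Proof.
rewrite le_eqVlt => /predU1P[<-|qu].
  by rewrite set_itv1 integral_set1 subrr.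
rewrite (@continuous_FTC2 _ _ (horner F)) ?EFinB//.
- by apply: continuous_in_subspaceT => x _; exact: continuous_horner.
- split.
  + by move=> x _; exact: derivable_horner.
  + by apply: cvg_at_right_filter; exact: continuous_horner.
  + by apply: cvg_at_left_filter; exact: continuous_horner.
- by move=> x _; rewrite derivE.
Qed.

(** The outer variable is the integration variable and the inner one the lower limit [q]: this is
    the integral of [Q] from [q] to the outer variable, as a polynomial in both. *)
Definition primitive2 (R : realType) (Q : {poly {poly R}}) : {poly {poly R}} :=
  \sum_(j < size Q) (Q`_j * (j.+1%:R^-1)%:P)%:P * ('X^(j.+1) - ('X^(j.+1))%:P).

Lemma integral_primitive2 (R : realType) (Q : {poly {poly R}}) (q u : R) : q <= u ->
  (\int[lebesgue_measure]_(t in `[q, u]) (Q.[t%:P].[q])%:E =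
   ((primitive2 Q).[u%:P].[q])%:E)%E.
Proof.
move=> qu.
pose F : {poly R} := \sum_(j < size Q) ((Q`_j).[q] / j.+1%:R) *: 'X^(j.+1).
have -> : (primitive2 Q).[u%:P].[q] = F.[u] - F.[q].
  rewrite /primitive2 /F !horner_sum -sumrB; apply: eq_bigr => j _.
  by rewrite !(hornerE, hornerXn) /= mulrBr.
rewrite -integral_deriv_poly//; apply: eq_integral => t _; congr EFin.
rewrite [Q.[_]]horner_coef horner_sum /F raddf_sum [RHS]horner_sum; apply: eq_bigr => j _ /=.
rewrite derivZ derivXn !hornerE /= hornerMn hornerXn -[t ^+ j *+ _]mulr_natr mulrA mulrAC -[_ / _ * _]mulrA.
by rewrite mulVf ?mulr1// pnatr_eq0.
Qed.

Fixpoint iterated_poly (R : realType) (c : seq nat) : {poly {poly R}} :=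
  if c is m :: c' then primitive2 ('X^(m.-1) * iterated_poly R c') else 1.

Lemma rev_iterated_integralE (R : realType) (q u : R) c : q <= u ->
  rev_iterated_integral q c u = (iterated_poly R c).[u%:P].[q].
Proof.
elim: c u => [|m c IH] u qu /=; first by rewrite !hornerE.
rewrite /Rintegral.
transitivity (fine (\int[lebesgue_measure]_(t in `[q, u])
    (('X^(m.-1) * iterated_poly R c).[t%:P].[q])%:E)%E); last by rewrite integral_primitive2.
congr fine; apply: eq_integral => t; rewrite inE /= in_itv /= => /andP[qt _].
by rewrite IH// !hornerE.
Qed.

(** Decreasing, because the outermost variable, which is the largest, comes first. *)
Definition chain (R : realType) k (q u : R) (s : 'rV[R]_k) :=
  [forall i, q <= s 0 i <= u] && [forall i : 'I_k, forall j : 'I_k, (i <= j)%N ==> (s 0 j <= s 0 i)].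

Lemma chain_row_mx (R : realType) k (q u x : R) (s : 'rV[R]_k) :
  chain q u (row_mx (x%:M : 'rV_1) s) = (q <= x <= u) && chain q x s.
Proof.
have x0 : row_mx (x%:M : 'rV_1) s 0 (lshift k 0) = x by rewrite row_mxEl !mxE mulr1n.
apply/andP/andP => [[/forallP s1 /forallP s2]|[qxu /andP[/forallP s1 /forallP s2]]].
  have s2' (i j : 'I_(1 + k)) : (i <= j)%N -> row_mx (x%:M : 'rV_1) s 0 j <= row_mx (x%:M : 'rV_1) s 0 i.
    by move=> ij; have /forallP/(_ j)/implyP := s2 i; apply.
  split; first by rewrite -x0.
  apply/andP; split.
    apply/forallP => i; have := s1 (rshift 1 i); rewrite row_mxEr => /andP[-> _] /=.
    by have := s2' (lshift k 0) (rshift 1 i) isT; rewrite row_mxEr x0.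
  apply/forallP => i; apply/forallP => j; apply/implyP => ij.
  by have := s2' (rshift 1 i) (rshift 1 j) ij; rewrite !row_mxEr.
have s1' i : q <= s 0 i <= x by exact: s1.
have /andP[qx xu] := qxu.
split.
  apply/forallP => i; case: (split_ordP i) => j ->; first by rewrite ord1 x0.
  by rewrite row_mxEr; have /andP[-> /le_trans->] := s1' j.
apply/forallP => i; apply/forallP => j; apply/implyP.
case: (split_ordP i) => i' ->; case: (split_ordP j) => j' ->; rewrite ?ord1 ?row_mxEr ?x0//.
  by move=> _; case/andP: (s1' j').
by rewrite /= !add1n ltnS => ij; have /forallP/(_ j')/implyP := s2 i'; apply.
Qed.

(** Induction on [k] by Fubini: fixing the first variable at [x] turns the upper limit [u] into [x]
    and moves a power of [x] into the constant [V]. Slices need only be known at nonzero entries,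
    since the value 0 of a variable is negligible. *)
Lemma lebesgue_row_chain (R : realType) k d (q u V : R) (c : 'I_k -> nat)
    (A : set 'rV[R]_(k + d)) : 0 <= q -> 0 <= V -> mrow A ->
  (forall s : 'rV[R]_k, (forall i, s 0 i != 0) ->
    lebesgue_row [set v : 'rV[R]_d | A (row_mx s v)] =
      (if chain q u s then V * \prod_i s 0 i ^+ (c i).-1 else 0)%:E) ->
  lebesgue_row A = (V * rev_iterated_integral q [seq c i | i <- enum 'I_k] u)%:E.
Proof.
move=> q0; elim: k u V c A => [u V c A V0 mA sliceA|k IH u V];
    last rewrite -[k.+1]/(1 + k)%N => c A V0 mA sliceA.
  have := sliceA 0 (fun i => False_ind _ (elimF idP erefl (ltn_ord i))).
  have -> : chain q u (0 : 'rV[R]_0) by apply/andP; split; apply/forallP => -[].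
  rewrite big_ord0 enum_ord0 /= => <-; congr lebesgue_row.
  by apply/seteqP; split => v /=; rewrite row_thin_mx.
have enumS : [seq c i | i <- enum 'I_(1 + k)] =
    c ord0 :: [seq c (lift ord0 i) | i <- enum 'I_k].
  by rewrite -[(1 + k)%N]/k.+1 enum_ordSl /= -map_comp.
rewrite enumS; set c' := (fun i => c (lift ord0 i)).
pose Vx x := if q <= x <= u then V * x ^+ (c ord0).-1 else 0.
have slice (x : R) : x != 0 ->
    lebesgue_row [set w : 'rV[R]_(k + d) | A (row_mx (x%:M : 'rV_1) w)] =
    (Vx x * rev_iterated_integral q [seq c' i | i <- enum 'I_k] x)%:E.
  move=> x0; apply: IH.
  - rewrite /Vx; case: ifP => // /andP[qx _]; rewrite mulr_ge0// exprn_ge0//.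
    exact: le_trans qx.
  - exact: (@mrow_slice R (k + d) A x mA).
  move=> s s0.
  transitivity (lebesgue_row [set v : 'rV[R]_d |
      A (row_mx (row_mx (x%:M : 'rV_1) s) v)]).
    congr lebesgue_row; apply/seteqP; split => v /=; rewrite row_mxA castmx_id//.
  rewrite sliceA; last first.
    by move=> i; case: (split_ordP i) => j ->; rewrite ?row_mxEr// row_mxEl ord1 !mxE mulr1n.
  rewrite chain_row_mx /Vx; case: (boolP (q <= x <= u)) => qxu /=; last by rewrite mul0r if_same.
  case: ifP => // _; congr EFin; rewrite -mulrA; congr (_ * _).
  rewrite big_split_ord big_ord1; congr (_ * _).
    by rewrite row_mxEl !mxE mulr1n; congr (_ ^+ (c _).-1); exact/val_inj.
  by apply: eq_bigr => i _; rewrite row_mxEr; congr (_ ^+ (c _).-1); exact/val_inj.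
pose Q := 'X^((c ord0).-1) * iterated_poly R [seq c' i | i <- enum 'I_k].
pose g (x : measurableTypeR R) : \bar R := (V * Q.[x%:P].[q])%:E.
have QE x : q <= x -> Q.[x%:P].[q] =
    x ^+ (c ord0).-1 * rev_iterated_integral q [seq c' i | i <- enum 'I_k] x.
  move=> qx; by rewrite rev_iterated_integralE// /Q !hornerE.
have mQ : measurable_fun setT (fun x : measurableTypeR R => (Q.[x%:P].[q] : measurableTypeR R)).
  rewrite (_ : (fun x => _) = horner (map_poly (horner_eval q) Q)).
    by apply: continuous_measurable_fun; exact: continuous_horner.
  by apply/funext => x; rewrite -[in RHS](hornerC x q) (horner_map (horner_eval q)).
have mg : measurable_fun setT g.
  by apply/measurable_EFinP; apply: measurable_funM.
rewrite (@lebesgue_rowS R (k + d)); last exact: mA.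
transitivity (\int[lebesgue_measure]_(x in `[q, u]) g x)%E.
  rewrite [RHS]integral_mkcond; apply: ae_eq_integral => //.
  - exact: (@measurable_slice R (k + d) A mA).
  - apply/measurable_restrict => //.
    by rewrite setTI; exact: measurable_funS mg.
  exists [set 0]; split=> //.
  - exact: lebesgue_measure_set1.
  move=> x /= H; apply: contrapT => /eqP x0; apply: H => _.
  rewrite slice// patchE /Vx; case: ifPn => qxu.
    rewrite mem_set /= ?in_itv// /g QE ?mulrA//.
    by case/andP: qxu.
  by rewrite mul0r memNset//= in_itv/=; apply/negP.
(* When [u < q] the range of integration is empty and both sides are 0. *)
have [qu|uq] := leP q u; last first.
  rewrite set_itv_ge ?bnd_simp -?ltNge// integral_set0 /=.
  by rewrite set_itv_ge ?bnd_simp -?ltNge// Rintegral_set0 mulr0.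
have mi : measurable (`[q, u]%classic : set (measurableTypeR R)) by exact: measurable_itv.
have Qint : (\int[lebesgue_measure]_(x in `[q, u]) (Q.[x%:P].[q])%:E)%E =
    (rev_iterated_integral q (c ord0 :: [seq c' i | i <- enum 'I_k]) u)%:E.
  by rewrite integral_primitive2// rev_iterated_integralE.
rewrite EFinM -Qint -integralZl//.
apply: continuous_compact_integrable; first exact: segment_compact.
apply: continuous_in_subspaceT => x _.
rewrite (_ : (fun x => _) = horner (map_poly (horner_eval q) Q)).
  exact: continuous_horner.
by apply/funext => y; rewrite -[in RHS](hornerC y q) (horner_map (horner_eval q)).
Qed.

(** * The volume of the lifting *)

(** All constraints of the face and of the lifting compare such forms with each other or with
    constants, which gives measurability. *)
Definition linear_form (R : realType) n (f : 'rV[R]_n -> R) :=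
  exists w, forall x, f x = dotrow w x.

Lemma linear_form_sum (R : realType) n (P : pred 'I_n) :
  linear_form (fun x : 'rV[R]_n => \sum_(i | P i) x 0 i).
Proof.
exists (\row_i (P i)%:R) => x; rewrite dotrowE big_mkcond; apply: eq_bigr => i _.
by rewrite mxE; case: (P i); rewrite ?mulr1 ?mulr0.
Qed.

Lemma linear_formZ (R : realType) n (f : 'rV[R]_n -> R) c :
  linear_form f -> linear_form (fun x => f x * c).
Proof.
move=> [w fE]; exists (c *: w) => x; rewrite fE !dotrowE mulr_suml.
by apply: eq_bigr => i _; rewrite mxE; ring.
Qed.

Lemma linear_formB (R : realType) n (f g : 'rV[R]_n -> R) :
  linear_form f -> linear_form g -> linear_form (fun x => f x - g x).
Proof.
move=> [w fE] [v gE]; exists (w - v) => x; rewrite fE gE !dotrowE -sumrB.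
by apply: eq_bigr => i _; rewrite !mxE mulrBr.
Qed.

Lemma mrow_ge_form (R : realType) n (f : 'rV[R]_n -> R) c :
  linear_form f -> mrow [set x | c <= f x].
Proof.
move=> [w fE]; have := mrow_le w c; congr mrow.
by apply/seteqP; split => x /=; rewrite fE.
Qed.

Lemma mrow_le_form (R : realType) n (f : 'rV[R]_n -> R) c :
  linear_form f -> mrow [set x | f x <= c].
Proof.
move=> lf; have := mrow_ge_form (- c) (linear_formZ (-1) lf); congr mrow.
by apply/seteqP; split => x /=; rewrite mulrN1 lerN2.
Qed.

Lemma mrow_le_forms (R : realType) n (f g : 'rV[R]_n -> R) :
  linear_form f -> linear_form g -> mrow [set x | f x <= g x].
Proof.
move=> lf lg; have := mrow_ge_form 0 (linear_formB lg lf); congr mrow.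
by apply/seteqP; split => x /=; rewrite subr_ge0.
Qed.

Lemma linear_form_ratio (R : realType) n k (z : {set 'I_n} -> R) (blk : 'I_n -> 'I_k) s :
  linear_form (block_ratio z blk s).
Proof. by apply: linear_formZ; exact: linear_form_sum. Qed.

Lemma mrow_lift_poly (R : realType) n k (z : {set 'I_n} -> R) (blk : 'I_n -> 'I_k) q :
  mrow (lift_poly z blk q).
Proof.
have lr := linear_form_ratio z blk.
have m1 : mrow [set y | forall s, q <= block_ratio z blk s y <= 1].
  apply: mrow_forall => s.
  have := mrowI (mrow_ge_form q (lr s)) (mrow_le_form 1 (lr s)); congr mrow.
  by apply/seteqP; split => y /= /andP.
have m2 : mrow [set y | forall p : 'I_k * 'I_k,
    (p.1 <= p.2)%N -> block_ratio z blk p.1 y <= block_ratio z blk p.2 y].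
  apply: mrow_forall => p; have [le|gt] := boolP (p.1 <= p.2)%N.
    by have := mrow_le_forms (lr p.1) (lr p.2); congr mrow; apply/seteqP; split => y //= ->.
  have : mrow [set: 'rV[R]_n] by exact: measurableT.
  by congr mrow; apply/seteqP; split => y //= _; rewrite (negbTE gt).
have m3 : mrow [set y | forall p : 'I_k * {set 'I_n},
    block_ratio z blk p.1 y * block_param z blk p.1 p.2 <=
    \sum_(i | (i \in p.2) && (blk i == p.1)) y 0 i].
  apply: mrow_forall => p; apply: mrow_le_forms; first exact: linear_formZ.
  exact: linear_form_sum.
have := mrowI (mrowI m1 m2) m3; congr mrow; apply/seteqP; split => y /=.
  by move=> [[y1 y2] y3]; split=> // [s t|s I]; [exact: (y2 (s, t))|exact: (y3 (s, I))].
by move=> [y1 y2 y3]; split; [split=> // -[s t]; exact: y2|move=> [s I]; exact: y3].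
Qed.

Lemma mrow_tight_face (R : realType) n k (z : {set 'I_n} -> R) (blk : 'I_n -> 'I_k) :
  z finset.set0 = 0 -> supermodular z -> mrow (tight_face z blk).
Proof.
move=> z0 z_super.
have m1 : mrow [set y : 'rV[R]_n | forall s, \sum_(i | blk i == s) y 0 i = level z blk s].
  apply: mrow_forall => s.
  have lf := linear_form_sum R (fun i => blk i == s).
  have := mrowI (mrow_ge_form (level z blk s) lf) (mrow_le_form (level z blk s) lf); congr mrow.
  apply/seteqP; split => y /= => [[y1 y2]|->]; last by split.
  by apply/le_anti/andP.
have m2 : mrow [set y : 'rV[R]_n | forall p : 'I_k * {set 'I_n},
    block_param z blk p.1 p.2 <= \sum_(i | (i \in p.2) && (blk i == p.1)) y 0 i].
  by apply: mrow_forall => p; apply: mrow_ge_form; exact: linear_form_sum.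
have := mrowI m1 m2; congr mrow; apply/seteqP; split => y /=.
  by move=> [y1 y2]; apply/tight_faceP => //; split=> // s I; exact: (y2 (s, I)).
by move=> /(tight_faceP _ _ z0 z_super)[y1 y2]; split=> // -[s I]; exact: y2.
Qed.

(** The face has a point, and the height is the sum of its positive coordinates over a nonempty
    block. *)
Lemma level_gt0 (R : realType) n k (z : {set 'I_n} -> R) (blk : 'I_n -> 'I_k) s :
  z finset.set0 = 0 -> supermodular z -> (exists i, blk i = s) ->
  (forall t, polytope_of z t -> forall i, 0 < t 0 i) -> 0 < level z blk s.
Proof.
move=> z0 z_super [i bi] P_pos; have [x Fx] := tight_face_neq0 blk z0 z_super.
have [xs _] := (tight_faceP blk x z0 z_super).1 Fx.
have x_pos := P_pos _ Fx.1.
rewrite -xs (bigD1 i) /= ?bi// ltr_pwDl// sumr_ge0// => j _; exact: ltW.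
Qed.

(* The blocks are listed in reverse order: the first coordinate of a row
   vector is the outermost variable for Fubini, i.e. the variable t_k. *)
Definition block_mat (R : realType) n k (blk : 'I_n -> 'I_k) : 'M[R]_(k, n) :=
  \matrix_(r, i) (blk i == rev_ord r)%:R.

Definition block_card n k (blk : 'I_n -> 'I_k) (s : 'I_k) : nat :=
  #|[set i | blk i == s]%SET|.

Lemma mul_block_mat_tr (R : realType) n k (blk : 'I_n -> 'I_k) p (X : 'M[R]_(p, n)) a r :
  (X *m (block_mat R blk)^T) a r = \sum_(i | blk i == rev_ord r) X a i.
Proof.
rewrite mxE [RHS]big_mkcond; apply: eq_bigr => i _; rewrite !mxE.
by case: ifP; rewrite ?mulr1 ?mulr0.
Qed.

Lemma mul_row_block_mat (R : realType) n k (blk : 'I_n -> 'I_k) (s : 'rV[R]_k) i :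
  (s *m block_mat R blk) 0 i = s 0 (rev_ord (blk i)).
Proof.
rewrite mxE (bigD1 (rev_ord (blk i)))//= big1 => [|r ri].
  by rewrite mxE rev_ordK eqxx mulr1 addr0.
by rewrite mxE -(inj_eq rev_ord_inj) rev_ordK eq_sym (negbTE ri) mulr0.
Qed.

Lemma block_mat_gram (R : realType) n k (blk : 'I_n -> 'I_k) :
  block_mat R blk *m (block_mat R blk)^T =
  diag_mx (\row_r (block_card blk (rev_ord r))%:R).
Proof.
apply/matrixP => r t; rewrite mul_block_mat_tr !mxE.
have [<-|rt] := eqVneq r t.
  rewrite mulr1n /block_card -sum1_card natr_sum.
  by apply: eq_big => [i|i /eqP bi]; rewrite ?inE// mxE bi eqxx.
rewrite mulr0n big1// => i /eqP bi; rewrite mxE bi (inj_eq rev_ord_inj) eq_sym.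
by rewrite (negbTE rt).
Qed.

Lemma block_card_gt0 n k (blk : 'I_n -> 'I_k) s :
  (exists i, blk i = s) -> (0 < block_card blk s)%N.
Proof. by move=> [i <-]; apply/card_gt0P; exists i; rewrite inE. Qed.

Lemma prod_rev_ord (R : realType) k (f : 'I_k -> R) :
  \prod_r f (rev_ord r) = \prod_s f s.
Proof. by rewrite [RHS](reindex_inj rev_ord_inj). Qed.

(** The Gram matrix of the rows is block diagonal, with the block sizes and the identity on the
    diagonal. *)
Lemma block_frame_unit (R : realType) k d (blk : 'I_(k + d) -> 'I_k) (M : 'M[R]_(d, k + d)) :
  (forall s, exists i, blk i = s) -> M *m M^T = 1%:M -> M *m (block_mat R blk)^T = 0 ->
  col_mx (block_mat R blk) M \in unitmx.
Proof.
move=> blk_surj MM MD.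
have DM : block_mat R blk *m M^T = 0 by rewrite -[LHS]trmxK trmx_mul trmxK MD trmx0.
have : \det (col_mx (block_mat R blk) M *m (col_mx (block_mat R blk) M)^T) != 0.
  rewrite tr_col_mx mul_col_row MM MD DM block_mat_gram det_ublock det1 mulr1 det_diag.
  apply/prodf_neq0 => r _; rewrite mxE pnatr_eq0 -lt0n block_card_gt0//.
by rewrite det_mulmx mulf_eq0 negb_or unitmxE unitfE => /andP[].
Qed.

(** The rows of [M] span the vectors with zero block sums: the difference of the two sides is
    orthogonal to a whole basis. *)
Lemma block_ker_frame (R : realType) k d (blk : 'I_(k + d) -> 'I_k)
    (M : 'M[R]_(d, k + d)) p (X : 'M[R]_(p, k + d)) :
  (forall s, exists i, blk i = s) -> M *m M^T = 1%:M -> M *m (block_mat R blk)^T = 0 ->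
  X *m (block_mat R blk)^T = 0 -> X = X *m M^T *m M.
Proof.
move=> blk_surj MM MD XD; apply/eqP; rewrite -subr_eq0.
have Bu := block_frame_unit blk_surj MM MD.
rewrite -unitmx_tr in Bu; apply/eqP; rewrite -[LHS](mulmxK Bu).
rewrite tr_col_mx mul_mx_row !mulmxBl XD -!mulmxA MM MD !mulmx0 mulmx1 !subrr.
by rewrite row_mx0 mul0mx.
Qed.

(** * The chart of the face and the finiteness of its volume *)

Definition face_center (R : realType) n k (z : {set 'I_n} -> R) (blk : 'I_n -> 'I_k) :
  'rV[R]_n := \row_i (level z blk (blk i) / (block_card blk (blk i))%:R).

Lemma sum_block_const (R : realType) n k (blk : 'I_n -> 'I_k) (f : 'I_k -> R) s :
  \sum_(i | blk i == s) f (blk i) = (block_card blk s)%:R * f s.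
Proof.
rewrite (eq_bigr (fun=> f s)) => [|i /eqP -> //].
by rewrite sumr_const mulr_natl /block_card cardsE.
Qed.

Lemma tight_face_range (R : realType) k d (z : {set 'I_(k + d)} -> R)
    (blk : 'I_(k + d) -> 'I_k) (M : 'M[R]_(d, k + d)) :
  z finset.set0 = 0 -> supermodular z ->
  (forall s, exists i, blk i = s) -> M *m M^T = 1%:M -> M *m (block_mat R blk)^T = 0 ->
  tight_face z blk `<=` range (flat_chart M (face_center z blk)).
Proof.
move=> z0 z_super blk_surj MM MD x /(tight_faceP _ _ z0 z_super)[xs _].
exists ((x - face_center z blk) *m M^T) => //; rewrite /flat_chart.
have XD : (x - face_center z blk) *m (block_mat R blk)^T = 0.
  apply/matrixP => a r; rewrite mul_block_mat_tr [RHS]mxE ord1.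
  rewrite (eq_bigr (fun i => x 0 i - level z blk (blk i) / (block_card blk (blk i))%:R)).
    rewrite sumrB xs (sum_block_const blk (fun s => level z blk s / (block_card blk s)%:R)) mulrC divfK ?subrr//.
    by rewrite pnatr_eq0 -lt0n block_card_gt0.
  by move=> i _; rewrite !mxE.
by rewrite -(block_ker_frame blk_surj MM MD XD) addrC subrK.
Qed.

(** The coordinates are positive with a fixed sum, so the face is bounded and its chart image fits
    in a box. *)
Lemma tight_face_volume_lty (R : realType) n k d (z : {set 'I_n} -> R)
    (blk : 'I_n -> 'I_k) (M : 'M[R]_(d, n)) (b : 'rV[R]_n) :
  z finset.set0 = 0 -> supermodular z ->
  (forall t, polytope_of z t -> forall i, 0 < t 0 i) ->
  M *m M^T = 1%:M ->
  (lebesgue_row (flat_chart M b @^-1` tight_face z blk) < +oo)%E.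
Proof.
move=> z0 z_super P_pos MM.
pose Z := z [set: 'I_n]%SET.
pose C := \sum_j \sum_i (`|Z| + `|b 0 i|) * `|M j i|.
apply: le_lt_trans (lebesgue_row_box d C).
apply: le_lebesgue_row; [by apply: mrow_flat_chart; exact: mrow_tight_face|exact: mrow_box|].
move=> u /= Fx j; set x := flat_chart M b u in Fx.
have x_pos := P_pos _ Fx.1.
have xZ i : `|x 0 i| <= `|Z|.
  rewrite (gtr0_norm (x_pos i)) (le_trans _ (ler_norm _))//.
  by rewrite /Z -Fx.1.1 (bigD1 i)//= lerDl sumr_ge0// => l _; exact: ltW.
have -> : u = (x - b) *m M^T by rewrite /x flat_chartKV.
rewrite mxE (le_trans (ler_norm_sum _ _ _))//.
rewrite /C [leRHS](bigD1 j)//=; apply: ler_wpDr.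
  by rewrite sumr_ge0// => l _; rewrite sumr_ge0// => i _; rewrite mulr_ge0 ?addr_ge0.
apply: ler_sum => i _; rewrite normrM [(x - b) 0 i]mxE [(- b) 0 i]mxE [M^T i j]mxE ler_wpM2r//.
by rewrite (le_trans (ler_normB _ _))// lerD2r xZ.
Qed.

(** * Coordinates adapted to the lifting, and its slices *)

Definition lift_frame (R : realType) k d (z : {set 'I_(k + d)} -> R)
    (blk : 'I_(k + d) -> 'I_k) (M : 'M[R]_(d, k + d)) : 'M[R]_(k + d) :=
  col_mx (diag_mx (\row_r (level z blk (rev_ord r) / (block_card blk (rev_ord r))%:R))
            *m block_mat R blk) M.

(** The square of the determinant is the Gram determinant of the rows; the Gram matrix is diagonal
    with entries [level ^ 2 / block_card] and 1. *)
Lemma det_lift_frame (R : realType) k d (z : {set 'I_(k + d)} -> R)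
    (blk : 'I_(k + d) -> 'I_k) (M : 'M[R]_(d, k + d)) :
  (forall s, exists i, blk i = s) -> (forall s, 0 < level z blk s) ->
  M *m M^T = 1%:M -> M *m (block_mat R blk)^T = 0 ->
  `|\det (lift_frame z blk M)| =
    (\prod_s level z blk s) / Num.sqrt (\prod_s (block_card blk s)%:R).
Proof.
move=> blk_surj h0 MM MD; rewrite -sqrtr_sqr.
have DM : block_mat R blk *m M^T = 0 by rewrite -[LHS]trmxK trmx_mul trmxK MD trmx0.
have m0 s : (block_card blk s)%:R != 0 :> R by rewrite pnatr_eq0 -lt0n block_card_gt0.
have -> : \det (lift_frame z blk M) ^+ 2 =
    (\prod_s level z blk s) ^+ 2 / \prod_s (block_card blk s)%:R.
  rewrite expr2 -{2}det_tr -det_mulmx /lift_frame tr_col_mx mul_col_row MM.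
  rewrite trmx_mul tr_diag_mx !mulmxA MD mul0mx.
  rewrite -[diag_mx _ *m _ *m M^T]mulmxA DM mulmx0 det_ublock det1 mulr1.
  rewrite -[diag_mx _ *m _ *m _]mulmxA block_mat_gram !mulmx_diag det_diag.
  rewrite -prodrXl -prodf_div -[RHS]prod_rev_ord; apply: eq_bigr => r _.
  by rewrite !mxE; field.
have P0 : 0 <= \prod_s level z blk s by apply: prodr_ge0 => s _; exact: ltW.
rewrite sqrtrM ?sqr_ge0// sqrtr_sqr ger0_norm// sqrtrV//.
by apply: prodr_ge0 => s _; rewrite ler0n.
Qed.

Lemma lift_frameE (R : realType) k d (z : {set 'I_(k + d)} -> R)
    (blk : 'I_(k + d) -> 'I_k) (M : 'M[R]_(d, k + d)) (s : 'rV[R]_k) (v : 'rV[R]_d) i :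
  (row_mx s v *m lift_frame z blk M) 0 i =
  s 0 (rev_ord (blk i)) * face_center z blk 0 i + (v *m M) 0 i.
Proof.
rewrite /lift_frame mul_row_col mxE; congr +%R.
rewrite mulmxA mul_row_block_mat mul_mx_diag !mxE rev_ordK //.
Qed.

Lemma block_ratio_lift_frame (R : realType) k d (z : {set 'I_(k + d)} -> R)
    (blk : 'I_(k + d) -> 'I_k) (M : 'M[R]_(d, k + d)) (s : 'rV[R]_k) (v : 'rV[R]_d) t :
  (forall s, exists i, blk i = s) -> (forall s, 0 < level z blk s) ->
  M *m (block_mat R blk)^T = 0 ->
  block_ratio z blk t (row_mx s v *m lift_frame z blk M) = s 0 (rev_ord t).
Proof.
move=> blk_surj h0 MD; rewrite /block_ratio.
have m0 : (block_card blk t)%:R != 0 :> R by rewrite pnatr_eq0 -lt0n block_card_gt0.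
rewrite (eq_bigr (fun i => s 0 (rev_ord (blk i)) *
   (level z blk (blk i) / (block_card blk (blk i))%:R) + (v *m M) 0 i)); last first.
  by move=> i _; rewrite lift_frameE mxE.
rewrite big_split /= (sum_block_const blk
  (fun t => s 0 (rev_ord t) * (level z blk t / (block_card blk t)%:R))).
rewrite (_ : \sum_(i | _) _ = 0) ?addr0; last first.
  have := mul_block_mat_tr blk (v *m M) 0 (rev_ord t).
  by rewrite -mulmxA MD mulmx0 mxE rev_ordK.
by field; rewrite m0 gt_eqF.
Qed.

(** Inverse factors, since this matrix carries a slice of the lifting back to the face. *)
Definition block_scaling (R : realType) n k (blk : 'I_n -> 'I_k) (s : 'rV[R]_k) : 'M[R]_n :=
  diag_mx (\row_i (s 0 (rev_ord (blk i)))^-1).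

Lemma block_mat_scaling (R : realType) n k (blk : 'I_n -> 'I_k) (s : 'rV[R]_k) :
  block_mat R blk *m block_scaling blk s =
  diag_mx (\row_r (s 0 r)^-1) *m block_mat R blk.
Proof.
apply/matrixP => r i; rewrite mul_mx_diag mul_diag_mx !mxE mulrC.
by case: eqVneq => [->|]; rewrite ?rev_ordK ?mulr0.
Qed.

(** Scaling by blocks preserves zero block sums, so it acts on the row space of [M]. *)
Lemma frame_scaling (R : realType) k d (blk : 'I_(k + d) -> 'I_k)
    (M : 'M[R]_(d, k + d)) (s : 'rV[R]_k) :
  (forall s, exists i, blk i = s) -> M *m M^T = 1%:M -> M *m (block_mat R blk)^T = 0 ->
  M *m block_scaling blk s = M *m block_scaling blk s *m M^T *m M.
Proof.
move=> blk_surj MM MD; apply: (block_ker_frame blk_surj MM MD).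
have tr_scaling : (block_scaling blk s)^T = block_scaling blk s by rewrite tr_diag_mx.
rewrite -mulmxA (_ : block_scaling blk s *m _ = (block_mat R blk *m block_scaling blk s)^T).
  by rewrite block_mat_scaling trmx_mul mulmxA MD mul0mx.
by rewrite trmx_mul tr_scaling.
Qed.

(** The scaling respects the splitting into block indicators and rows of [M]. Its full determinant
    has each inverse factor to the power of the block size, and the indicator part takes away one of
    them per block; hence the exponent lowered by 1. *)
Lemma det_frame_scaling (R : realType) k d (blk : 'I_(k + d) -> 'I_k)
    (M : 'M[R]_(d, k + d)) (s : 'rV[R]_k) :
  (forall s, exists i, blk i = s) -> M *m M^T = 1%:M -> M *m (block_mat R blk)^T = 0 ->
  (forall r, s 0 r != 0) ->
  (\det (M *m block_scaling blk s *m M^T))^-1 =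
    \prod_r s 0 r ^+ (block_card blk (rev_ord r)).-1.
Proof.
move=> blk_surj MM MD s0; set K := _ *m M^T.
have Bu := block_frame_unit blk_surj MM MD.
have : \det (col_mx (block_mat R blk) M *m block_scaling blk s) =
    \det (block_mx (diag_mx (\row_r (s 0 r)^-1)) 0 0 K *m col_mx (block_mat R blk) M).
  rewrite mul_block_col !mul0mx addr0 add0r mul_col_mx block_mat_scaling.
  by rewrite (frame_scaling s blk_surj MM MD).
rewrite !det_mulmx [LHS]mulrC => /mulIf; rewrite -unitfE -unitmxE => /(_ Bu).
rewrite det_ublock !det_diag => dK.
have prodV : \prod_r (\row_r (s 0 r)^-1 : 'rV[R]_k) 0 r != 0.
  by apply/prodf_neq0 => r _; rewrite mxE invr_eq0.
have -> : \det K = (\prod_i (\row_i (s 0 (rev_ord (blk i)))^-1 : 'rV[R]_(k + d)) 0 i) /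
    \prod_r (\row_r (s 0 r)^-1 : 'rV[R]_k) 0 r by rewrite dK mulrC mulKf.
rewrite (partition_big blk xpredT)//= -[X in _ / X]prod_rev_ord -prodf_div -prodfV.
rewrite -[RHS]prod_rev_ord; apply: eq_bigr => r _.
rewrite (eq_bigr (fun=> (s 0 (rev_ord r))^-1)); last by move=> i /eqP <-; rewrite mxE.
rewrite prodr_const mxE invrK exprVn rev_ordK.
have := block_card_gt0 (blk_surj r); rewrite /block_card cardsE; case: #|_| => // m _.
by rewrite exprS invfM !invrK mulrAC mulfV ?mul1r.
Qed.

(** On the slice the ratios are the entries of [s], so the conditions on them amount to [chain], and
    dividing the blocks by them yields points of the face. *)
Lemma lift_frame_slice (R : realType) k d (z : {set 'I_(k + d)} -> R)
    (blk : 'I_(k + d) -> 'I_k) (M : 'M[R]_(d, k + d)) (q : R) (s : 'rV[R]_k) :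
  z finset.set0 = 0 -> supermodular z ->
  (forall s, exists i, blk i = s) -> (forall s, 0 < level z blk s) ->
  M *m M^T = 1%:M -> M *m (block_mat R blk)^T = 0 -> 0 <= q ->
  (forall r, s 0 r != 0) ->
  [set v : 'rV[R]_d | lift_poly z blk q (row_mx s v *m lift_frame z blk M)] =
  if chain q 1 s then
    [set v | tight_face z blk (flat_chart M (face_center z blk)
       (v *m (M *m block_scaling blk s *m M^T)))]
  else set0.
Proof.
move=> z0 z_super blk_surj h0 MM MD q0 s0.
have rE v t : block_ratio z blk t (row_mx s v *m lift_frame z blk M) = s 0 (rev_ord t).
  exact: block_ratio_lift_frame.
case: ifPn => [/andP[/forallP s1 /forallP s2]|nchain]; last first.
  apply/seteqP; split => // v [y1 y2 _]; apply: (negP nchain); apply/andP; split.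
    by apply/forallP => r; have := y1 (rev_ord r); rewrite rE rev_ordK.
  apply/forallP => r; apply/forallP => t; apply/implyP => rt.
  by have := y2 (rev_ord t) (rev_ord r); rewrite !rE !rev_ordK; apply => /=; rewrite leq_sub2l.
pose rho t := s 0 (rev_ord t).
have rho0 t : rho t != 0 by exact: s0.
have xE v : flat_chart M (face_center z blk) (v *m (M *m block_scaling blk s *m M^T)) =
    scale_blocks blk (fun t => (rho t)^-1) (row_mx s v *m lift_frame z blk M).
  rewrite /flat_chart -mulmxA -(frame_scaling s blk_surj MM MD) mulmxA.
  apply/rowP => i; rewrite [in RHS]mxE lift_frameE mulrDr mulKf ?rho0// [LHS]mxE; congr +%R.
  by rewrite mul_mx_diag !mxE mulrC.
have scaleK y : scale_blocks blk rho (scale_blocks blk (fun t => (rho t)^-1) y) = y.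
  by apply/rowP => i; rewrite !mxE mulVKf ?rho0.
have scaleVK y : scale_blocks blk (fun t => (rho t)^-1) (scale_blocks blk rho y) = y.
  by apply/rowP => i; rewrite !mxE mulKf ?rho0.
apply/seteqP; split => v /=; rewrite xE.
  move=> Ly; have [x Fx yE] := lift_poly_scale_blocks z0 z_super h0 q0 Ly.
  have -> : row_mx s v *m lift_frame z blk M = scale_blocks blk rho x.
    by rewrite yE; congr scale_blocks; apply/funext => t; rewrite rE.
  by rewrite scaleVK.
move=> Fx; rewrite -[_ *m lift_frame _ _ _]scaleK; apply: scale_blocks_lift_poly => //.
  by move=> t; exact: s1.
move=> t t' tt'; have /forallP/(_ (rev_ord t))/implyP := s2 (rev_ord t'); apply.
by rewrite /= leq_sub2l.
Qed.

Theorem lift_poly_volume (R : realType) k d (z : {set 'I_(k + d)} -> R)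
    (blk : 'I_(k + d) -> 'I_k) (q V : R) (M : 'M[R]_(d, k + d)) :
  z finset.set0 = 0 -> supermodular z ->
  (forall s, exists i, blk i = s) -> (forall s, 0 < level z blk s) ->
  M *m M^T = 1%:M -> M *m (block_mat R blk)^T = 0 -> 0 <= q ->
  lebesgue_row (flat_chart M (face_center z blk) @^-1` tight_face z blk) = V%:E ->
  lebesgue_row (lift_poly z blk q) =
    ((\prod_s level z blk s) / Num.sqrt (\prod_s (block_card blk s)%:R) * V *
     rev_iterated_integral q [seq block_card blk (rev_ord r) | r <- enum 'I_k] 1)%:E.
Proof.
move=> z0 z_super blk_surj h0 MM MD q0 VE.
have dB := det_lift_frame blk_surj h0 MM MD.
set B := lift_frame z blk M in dB.
have V0 : 0 <= V by rewrite -lee_fin -VE lebesgue_row_ge0.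
have dB0 : 0 < `|\det B|.
  rewrite dB divr_gt0//; first by apply: prodr_gt0 => s _; exact: h0.
  by rewrite sqrtr_gt0; apply: prodr_gt0 => s _; rewrite ltr0n block_card_gt0.
have Bu : B \in unitmx by rewrite unitmxE unitfE -normr_gt0.
have mL := mrow_lift_poly z blk q.
have mA : mrow [set y | lift_poly z blk q (y *m B + 0)] by exact: mrow_affine.
have := lebesgue_row_affine 0 Bu mL.
rewrite (lebesgue_row_chain (u := 1) (c := fun r => block_card blk (rev_ord r)) q0 V0 mA).
  move=> E; rewrite -mulrA -dB EFinM E.
  by rewrite muleA -EFinM mulfV ?gt_eqF// mul1e.
move=> s s0; rewrite (_ : [set v | _] = [set v | lift_poly z blk q (row_mx s v *m B)]); last first.
  by apply/seteqP; split => v /=; rewrite addr0.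
rewrite lift_frame_slice//; case: ifPn => [/andP[/forallP s1 _]|_]; last first.
  by rewrite lebesgue_rowE preimage_set0 measure0.
set K := M *m block_scaling blk s *m M^T.
have dK : (\det K)^-1 = _ := det_frame_scaling blk_surj MM MD s0.
have dK0 : (\det K)^-1 != 0 by rewrite dK; apply/prodf_neq0 => r _; rewrite expf_neq0.
have Ku : K \in unitmx by rewrite unitmxE unitfE -invr_eq0.
have := lebesgue_row_affine 0 Ku (mrow_flat_chart M (face_center z blk) (mrow_tight_face blk z0 z_super)).
rewrite VE -normfV dK => E; transitivity (`|\prod_r s 0 r ^+ (block_card blk (rev_ord r)).-1|%:E * V%:E)%E.
  by rewrite -E; congr lebesgue_row; apply/seteqP; split => v /=; rewrite addr0.
rewrite -EFinM mulrC ger0_norm//; apply: prodr_ge0 => r _.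
by have /andP[qs _] := s1 r; rewrite exprn_ge0// (le_trans q0).
Qed.

(** Matches the reversed block order of the frame with the reversed list in [iterated_integral]. *)
Lemma rev_enum_ord k : rev (enum 'I_k) = [seq rev_ord r | r <- enum 'I_k].
Proof.
apply: (inj_map val_inj); rewrite map_rev val_enum_ord.
rewrite (_ : map _ _ = [seq (k - i.+1)%N | i <- [seq val r | r <- enum 'I_k]]).
  rewrite val_enum_ord.
  apply: (@eq_from_nth _ 0%N) => [|i]; rewrite size_rev ?size_map// size_iota => ik.
  by rewrite nth_rev ?size_iota// (nth_map 0%N) ?size_iota// !nth_iota// ltn_subrL (leq_trans _ ik).
by rewrite -[RHS]map_comp -[LHS]map_comp.
Qed.

Theorem theorem5p9 (R : realType) (n k : nat) (z : {set 'I_n} -> R)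
    (z0 : z (finset.set0) = 0) (z_super : supermodular z)
    (P_pos : forall t : 'rV[R]_n, polytope_of z t -> forall i, 0 < t 0 i)
    (pi : 'I_k -> {set 'I_n}) (pi_part : ordered_partition pi)
    (a : 'rV[R]_n) (a_type : has_type pi a) :
  let P_pi := max_face (polytope_of z) a in
  (forall q : R, 0 <= q <= 1 ->
     lebesgue_row (lifting pi q P_pi) =
       (((\prod_s block_height z pi s)
           / Num.sqrt (\prod_s (#|pi s|)%:R))%:E
        * flat_volume (n - k) P_pi
        * (iterated_integral q (fun s => #|pi s|))%:E)%E) /\
  (exists p : {poly R}, forall q : R, 0 <= q <= 1 ->
     lebesgue_row (lifting pi q P_pi) = (p.[q])%:E).
Proof.
have [blk [blk_surj piE]] := ordered_partition_block pi_part.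
subst pi => P_pi.
(* A section of the surjection [blk] is injective, so [k <= n]. *)
have [d nE] : exists d, n = (k + d)%N.
  have [f fK] := choice blk_surj.
  have : (#|'I_k| <= #|'I_n|)%N by apply: (leq_card f); exact: can_inj fK.
  by rewrite !card_ord => kn; exists (n - k)%N; rewrite subnKC.
subst n.
have PE : P_pi = tight_face z blk by exact: max_face_tight.
have h0 s : 0 < level z blk s by exact: level_gt0.
have [M [MM MD]] : exists M : 'M[R]_(d, k + d),
    M *m M^T = 1%:M /\ M *m (block_mat R blk)^T = 0.
  by apply: orthonormal_ker; rewrite addnC.
have FM := tight_face_range z0 z_super blk_surj MM MD.
have volE := flat_volumeE MM (mrow_tight_face blk z0 z_super) FM.
have [V VE] : exists V,
    lebesgue_row (flat_chart M (face_center z blk) @^-1` tight_face z blk) = V%:E.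
  eexists; apply/esym/fineK; rewrite ge0_fin_numE ?lebesgue_row_ge0//.
  exact: tight_face_volume_lty.
have main q : 0 <= q <= 1 ->
    lebesgue_row (lifting (fun s => [set i | blk i == s]%SET) q P_pi) =
    ((\prod_s level z blk s) / Num.sqrt (\prod_s (block_card blk s)%:R) * V *
     rev_iterated_integral q [seq block_card blk (rev_ord r) | r <- enum 'I_k] 1)%:E.
  move=> q01; rewrite PE liftingE//; have /andP[q0 _] := q01.
  exact: (lift_poly_volume z0 z_super blk_surj h0 MM MD q0 VE).
split=> [q q01|].
  rewrite main// addKn PE volE VE -!EFinM; congr EFin; congr (_ * _ * _).
    by congr (_ / _); apply: eq_bigr => s _; rewrite /block_height !first_blocksE.
  by rewrite /iterated_integral -map_rev rev_enum_ord -map_comp.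
(* Fixing the outer variable of [iterated_poly] at the upper limit 1 leaves a polynomial in [q]. *)
exists ((\prod_s level z blk s) / Num.sqrt (\prod_s (block_card blk s)%:R) * V *:
  (iterated_poly R [seq block_card blk (rev_ord r) | r <- enum 'I_k]).[1%:P]).
move=> q q01; rewrite main// hornerZ rev_iterated_integralE//.
by case/andP: q01.
Qed.
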